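(* Let $d\ge1$, $p\in[1,\infty)$ and $f\in N^{1,p}$. Then $f$ is weakly differentiable at Lebesgue-a.e. point of $\mathbb{R}^d$. Denoting by $\nabla f$ its weak differential, the following hold. (i) There is a constant $C>0$ depending only on $d$ and $p$ (not on $f$) such that $$\int_{\mathbb{R}^d}\big[\log(1+|\nabla f(x)|)\big]^p\,dx\le C\,[f]_{N^{1,p}}^p .$$ (ii) For Lebesgue-a.e. $x\in\mathbb{R}^d$, $$\lim_{r\to0^+}\frac1{|B_r|}\int_{B_r}\left[\log\left(1+\frac{|f(x+y)-f(x)-\nabla f(x)\cdot y|}{|y|}\right)\right]^p dy=0 .$$
   Context: Functions $f$ are real-valued, measurable and everywhere defined on $\mathbb{R}^d$ (a representative is fixed); $B_r$ is the open Euclidean ball of radius $r$ centered at the origin and $|B_r|$ its Lebesgue measure. For $p\in[1,\infty)$, a function $f\in L^p_{\mathrm{loc}}(\mathbb{R}^d)$ belongs to $N^{1,p}$ if there is a measurable $g:\mathbb{R}^d\to[0,\infty]$ with $g\in L^p(\mathbb{R}^d)$ such that $$|f(x)-f(y)|\le |x-y|\big(\exp\{g(x)+g(y)\}-1\big)\qquad\text{for all }x\neq y\in\mathbb{R}^d$$ (with $\exp(\infty)=\infty$), and $[f]_{N^{1,p}}$ is the infimum of $\|g\|_{L^p}$ over all such $g$. A measurable function $f$ is weakly differentiable at $x\in\mathbb{R}^d$ if there is a linear map $L:\mathbb{R}^d\to\mathbb{R}$ such that for every $0<R<\infty$ $$\lim_{r\to0^+}\int_{B_R}\min\left\{\left|\frac{f(x+ry)-f(x)-L(ry)}{r|y|}\right|,1\right\}dy=0;$$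 one then writes $L(y)=\nabla f(x)\cdot y$ with $\nabla f(x)\in\mathbb{R}^d$. *)

(* Defs.v *)
From HB Require Import structures.
From mathcomp Require Import all_boot all_order all_algebra.
From mathcomp Require Import all_classical all_reals all_analysis measurable_realfun.

Set Implicit Arguments.
Unset Strict Implicit.
Unset Printing Implicit Defensive.
Import Order.TTheory GRing.Theory Num.Theory.
Import numFieldNormedType.Exports.

Local Open Scope classical_set_scope.
Local Open Scope ring_scope.

(* Lebesgue measure on R^d.  The library has no d-dimensional Lebesgue measure:
   the d-fold product of the one-dimensional one is built on the Borel sets of
   d.-tuple R, carried over to 'rV[R]_d, and completed, so that the measurable
   subsets of 'rV[R]_d are exactly the Lebesgue measurable ones. *)

Section iterated_product.
Context {R : realType} (n : nat).
Variable m : {sigma_finite_measure set (n.-tuple R) -> \bar R}.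

Definition tcons (p : measurableTypeR R * n.-tuple R) : n.+1.-tuple R :=
  [tuple of p.1 :: p.2].

Lemma measurable_tcons : measurable_fun [set: _] tcons.
Proof.
exact: (@measurable_cons _ _ _ R).
Qed.

Definition tuple_measureS : set (n.+1.-tuple R) -> \bar R :=
  pushforward (@lebesgue_measure R \x m)%E tcons.

Let tuple_measureS0 : tuple_measureS set0 = 0%E.
Proof. by rewrite /tuple_measureS /pushforward preimage_set0 measure0. Qed.

Let tuple_measureS_ge0 A : (0 <= tuple_measureS A)%E.
Proof. by rewrite /tuple_measureS /pushforward measure_ge0. Qed.

Let tuple_measureS_sigma_additive : semi_sigma_additive tuple_measureS.
Proof.
move=> F mF tF mUF; rewrite /tuple_measureS /pushforward preimage_bigcup.
apply: measure_semi_sigma_additive.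
- by move=> k; rewrite -[X in measurable X]setTI; exact: measurable_tcons.
- apply/trivIsetP => /= i j _ _ ij; rewrite -preimage_setI.
  by move/trivIsetP : tF => /(_ _ _ _ _ ij) ->//; rewrite preimage_set0.
- by rewrite -preimage_bigcup -[X in measurable X]setTI; exact: measurable_tcons.
Qed.

HB.instance Definition _ := isMeasure.Build _ _ _ tuple_measureS
  tuple_measureS0 tuple_measureS_ge0 tuple_measureS_sigma_additive.

Let tuple_measureS_sigma_finite : sigma_finite [set: _] tuple_measureS.
Proof.
have /sigma_finiteP[F [TF ndF Foo]] := sigma_finiteT (@lebesgue_measure R).
have /sigma_finiteP[G [TG ndG Goo]] := sigma_finiteT m.
pose u (t : n.+1.-tuple R) : measurableTypeR R * n.-tuple R :=
  (thead t, [tuple of behead t]).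
have mtu : measurable_fun [set: _] u.
  apply/measurable_fun_pair; first exact: (@measurable_tnth _ R).
  exact: (@measurable_behead _ R).
exists (fun k => u @^-1` (F k `*` G k)).
  apply/seteqP; split => // t _.
  have [i _ Fix] : (\bigcup_i F i) (u t).1 by rewrite -TF.
  have [j _ Gjy] : (\bigcup_j G j) (u t).2 by rewrite -TG.
  exists (maxn i j) => //; split.
  - by have /subsetPset := ndF _ _ (leq_maxl i j); exact.
  - by have /subsetPset := ndG _ _ (leq_maxr i j); exact.
move=> k; have [mF Fk] := Foo k; have [mG Gk] := Goo k; split.
  by rewrite -[X in measurable X]setTI; apply: mtu => //; exact: measurableX.
rewrite /tuple_measureS /pushforward -comp_preimage.
have -> : u \o tcons = id.
  by apply/funext => -[x t]; congr pair; exact/val_inj.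
by rewrite preimage_id product_measure1E// lte_mul_pinfty// ge0_fin_numE.
Qed.

HB.instance Definition _ := Measure_isSigmaFinite.Build _ _ _ tuple_measureS
  tuple_measureS_sigma_finite.

End iterated_product.

Fixpoint tuple_measure (R : realType) (n : nat) :
    {sigma_finite_measure set (n.-tuple R) -> \bar R} :=
  if n is k.+1 then tuple_measureS (tuple_measure R k)
  else @dirac _ (0.-tuple R) [tuple] R.

Lemma tuple_measure_box (R : realType) (n : nat) (a b : 'I_n -> R) :
  (forall i, a i <= b i) ->
  measurable [set t : n.-tuple R | forall i, tnth t i \in `]a i, b i]] /\
  tuple_measure R n [set t | forall i, tnth t i \in `]a i, b i]] =
    (\prod_i (b i - a i))%:E.
Proof.
elim: n a b => [|n ih] a b ab.
  have -> : [set t : 0.-tuple R | forall i, tnth t i \in `]a i, b i]] = setT.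
    by apply/seteqP; split => // t _ [].
  by rewrite big_ord0 /= diracT.
pose a' i := a (lift ord0 i); pose b' i := b (lift ord0 i).
have [mB Bab] := ih a' b' (fun i => ab (lift ord0 i)).
set B := [set t | _] in mB Bab.
set A := [set t | _].
have AE : A = [set t | thead t \in `]a ord0, b ord0]] `&`
              ((fun t : n.+1.-tuple R => [tuple of behead t]) @^-1` B).
  apply/seteqP; split => t /= At; last first.
    case: At => At0 At i; case: (unliftP ord0 i) => [j ->|-> //].
    by have := At j; rewrite [X in tnth X (lift _ _)](tuple_eta t) tnthS.
  split; first exact: At.
  by move=> i /=; have := At (lift ord0 i); rewrite {1}(tuple_eta t) tnthS.
split.
  rewrite AE; apply: measurableI.
    have := @measurable_tnth _ R n.+1 ord0 measurableT _ (measurable_itv `]a ord0, b ord0]).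
    by rewrite setTI.
  by have := @measurable_behead _ R n measurableT _ mB; rewrite setTI.
rewrite /= /tuple_measureS /pushforward.
have -> : @tcons R n @^-1` A = `]a ord0, b ord0]%classic `*` B.
  rewrite AE; apply/seteqP; split => -[x t] /= [xab Bt]; split => //.
    by have -> : t = [tuple of behead (tcons (x, t))] by exact/val_inj.
  by have -> : [tuple of behead (tcons (x, t))] = t by exact/val_inj.
have -> : (lebesgue_measure \x tuple_measure R n)%E (`]a ord0, b ord0]%classic `*` B) =
    (@lebesgue_measure R `]a ord0, b ord0]%classic * tuple_measure R n B)%E.
  by rewrite product_measure1E.
rewrite Bab lebesgue_measure_itv/= lte_fin big_ord_recl EFinM.
congr (_ * _)%E; case: ltP => [_|ba]; first by rewrite EFinB.
by rewrite (@le_anti _ _ (a ord0) (b ord0)) ?ab ?ba// subrr.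
Qed.

Section lebesgue_rV.
Context (R : realType) (d : nat).

Definition row_of_tuple (t : d.-tuple R) : 'rV[R]_d := \row_i tnth t i.

Definition outer_lebesgue (A : set 'rV[R]_d) : \bar R :=
  mu_ext (tuple_measure R d) (row_of_tuple @^-1` A).

Let outer_lebesgue0 : outer_lebesgue set0 = 0%E.
Proof. by rewrite /outer_lebesgue preimage_set0 outer_measure0. Qed.

Let outer_lebesgue_ge0 A : (0 <= outer_lebesgue A)%E.
Proof. exact: outer_measure_ge0. Qed.

Let le_outer_lebesgue :
  {homo outer_lebesgue : A B / A `<=` B >-> (A <= B)%E}.
Proof. by move=> A B AB; apply: le_outer_measure => t; exact: AB. Qed.

Let outer_lebesgue_sigma_subadditive : sigma_subadditive outer_lebesgue.
Proof.
move=> F; rewrite /outer_lebesgue preimage_bigcup.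
exact: outer_measure_sigma_subadditive.
Qed.

HB.instance Definition _ := isOuterMeasure.Build R 'rV[R]_d outer_lebesgue
  outer_lebesgue0 outer_lebesgue_ge0 le_outer_lebesgue
  outer_lebesgue_sigma_subadditive.

HB.instance Definition _ := @isMeasurable.Build (caratheodory_display outer_lebesgue)
  'rV[R]_d (caratheodory_measurable outer_lebesgue)
  (caratheodory_measurable_set0 outer_lebesgue)
  (@caratheodory_measurable_setC _ _ outer_lebesgue)
  (@caratheodory_measurable_bigcup _ _ outer_lebesgue).

Definition lebesgue_rV : set 'rV[R]_d -> \bar R := outer_lebesgue.

HB.instance Definition _ := isMeasure.Build _ _ _ lebesgue_rV
  (@caratheodory_measure0 R 'rV[R]_d outer_lebesgue)
  (@caratheodory_measure_ge0 R 'rV[R]_d outer_lebesgue)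
  (@caratheodory_measure_sigma_additive R 'rV[R]_d outer_lebesgue).

End lebesgue_rV.

Lemma lebesgue_rV_box (R : realType) (d : nat) (a b : 'rV[R]_d) :
  (forall i, a 0 i <= b 0 i) ->
  lebesgue_rV [set x | forall i, x 0 i \in `]a 0 i, b 0 i]] =
    (\prod_i (b 0 i - a 0 i))%:E.
Proof.
move=> ab; have [mB Bab] := tuple_measure_box ab.
rewrite /lebesgue_rV /outer_lebesgue -Bab -measurable_mu_extE//.
congr mu_ext; apply/seteqP; split => t /= tab i; have := tab i; by rewrite mxE.
Qed.

Lemma lebesgue_rV_is_complete (R : realType) (d : nat) :
  measure_is_complete (@lebesgue_rV R d).
Proof. exact: (@measure_is_complete_caratheodory R 'rV[R]_d (@outer_lebesgue R d)). Qed.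

Section weak_differentiability.
Context (R : realType) (d : nat).
Implicit Types (x y u v : 'rV[R]_d) (f : 'rV[R]_d -> R) (g : 'rV[R]_d -> \bar R).

Definition dotv u v : R := \sum_i u 0 i * v 0 i.

(* The library's norm `|v| on 'rV[R]_d is the sup norm. *)
Definition enorm v : R := Num.sqrt (dotv v v).

Definition eball (r : R) : set 'rV[R]_d := [set y | enorm y < r].

Definition Lp_loc (p : R) f : Prop :=
  measurable_fun [set: 'rV[R]_d] f /\
  forall K : set 'rV[R]_d, compact K ->
    (\int[@lebesgue_rV R d]_(x in K) (`|f x| `^ p)%:E < +oo)%E.

Definition N1p_majorant (p : R) f g : Prop :=
  [/\ measurable_fun [set: 'rV[R]_d] g,
      forall x, (0 <= g x)%E,
      (Lnorm (@lebesgue_rV R d) p%:E g < +oo)%E &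
      forall x y, x <> y ->
        (`|f x - f y|%:E <=
         (enorm (x - y))%:E * (expeR (g x + g y) - 1))%E].

Definition N1p (p : R) f : Prop :=
  Lp_loc p f /\ exists g, N1p_majorant p f g.

Definition N1p_seminorm (p : R) f : \bar R :=
  ereal_inf [set Lnorm (@lebesgue_rV R d) p%:E g | g in N1p_majorant p f].

Definition is_weak_differential f x (L : 'rV[R]_d -> R) : Prop :=
  linear (L : 'rV[R]_d -> R^o) /\
  forall rho : R, 0 < rho ->
    (\int[@lebesgue_rV R d]_(y in eball rho)
       (Num.min `|(f (x + r *: y) - f x - L (r *: y)) / (r * enorm y)| 1)%:E)%E
      @[r --> 0^'+] --> 0%E.

Definition weakly_differentiable f x : Prop :=
  exists L, is_weak_differential f x L.

(* 0 at the points where f is not weakly differentiable. *)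
Definition weak_gradient f x : 'rV[R]_d :=
  xget 0 [set v | is_weak_differential f x (dotv v)].

End weak_differentiability.

(* Main.v *)
(* If [g] is a majorant of [f], then [f] is Lipschitz on each sublevel [{g <= q}], with constant
   [exp (2 q) - 1], and extends to a Lipschitz function [F] on the whole space, which is
   differentiable almost everywhere by Rademacher's theorem.  Almost every point [x] of the sublevel
   is moreover such that the integral of [1 + g ^ p] over the part of the ball of radius [r] around
   [x] lying outside the sublevel is [o(r ^ d)].  At such a point the gradient of [F] is the weak
   gradient of [f]; its norm is at most [exp (2 q) - 1], so that [ln (1 + |grad f|) <= 2 g] almost
   everywhere upon letting the rational [q] decrease to [g x]; and the integrand of the last claim
   is small on the sublevel and at most [C (1 + g (x + y) ^ p)] outside of it.

   Rademacher's theorem is reduced to the a.e. differentiability of Lipschitz functions of one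
   variable: at a density point of the set where the partial difference quotients are uniformly
   within [e] of a fixed rational vector, [F] is affine up to [O(e |y|)]. *)

Require Import Defs.
From HB Require Import structures.
From mathcomp Require Import all_boot all_order all_algebra.
From mathcomp Require Import all_classical all_reals all_analysis measurable_realfun.
From mathcomp Require Import ring lra.

Set Implicit Arguments.
Unset Strict Implicit.
Unset Printing Implicit Defensive.
Import Order.TTheory GRing.Theory Num.Theory.
Import numFieldNormedType.Exports.

Local Open Scope classical_set_scope.
Local Open Scope ring_scope.

(** * Row vectors with the sup norm, whose balls are cubes *)

(** Uniqueness of the weak gradient ties the pieces together: the extension [F] depends on the
    majorant and on the level, but its gradient at a good point does not. Hence the level may tend
    to [g x], and the resulting bound, with constant [2 ^ p] because [g] enters twice in the
    exponent, may be minimised over all majorants.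

    Differentiation of integrals is proved in a special form: a nonnegative function, at points of a
    set where it vanishes. There a Vitali covering, outer regularity and absolute continuity of the
    integral suffice. Applied to the indicator of a complement it gives density points; applied to
    [1 + g ^ p] cut off on a sublevel it gives the points of the overview.

    Measurability shapes several statements. The product sigma-algebra and Fubini's theorem live on
    tuples, the topology on rows, and the measurable sets of rows come from Caratheodory's
    condition. Arguments by slices therefore use sets with Borel preimage, which closedness
    supplies, while the weak gradient, chosen point by point, is measurable by completeness, as an
    almost everywhere limit of difference quotients. *)

Lemma ex_natSinv_lt (R : realType) (e : R) : 0 < e -> exists n : nat, n.+1%:R^-1 < e.
Proof.
move=> e0; have [n _ /(_ n (leqnn n)) /= ne] := near_infty_natSinv_lt (PosNum e0).
by exists n.
Qed.

Section row_vectors.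
Context {R : realType} {d : nat}.
Implicit Types (x y : 'rV[R]_d) (r : R).

Lemma norm_coord_le x i : `|x 0 i| <= `|x|.
Proof.
by rewrite /Num.norm /= mx_normrE (le_bigmax _ (fun ij => `|x ij.1 ij.2|) (0, i)).
Qed.

Lemma rV_norm_ltP x r : 0 < r -> reflect (forall i, `|x 0 i| < r) (`|x| < r).
Proof.
move=> r0; apply: (iffP idP) => [xr i|xr]; first exact: le_lt_trans (norm_coord_le x i) xr.
rewrite /Num.norm /= mx_normrE; apply/bigmax_ltP; split => // -[i j] _ /=.
by rewrite (ord1 i).
Qed.

Lemma rV_norm_leP x r : 0 <= r -> reflect (forall i, `|x 0 i| <= r) (`|x| <= r).
Proof.
move=> r0; apply: (iffP idP) => [xr i|xr]; first exact: le_trans (norm_coord_le x i) xr.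
rewrite /Num.norm /= mx_normrE; apply/bigmax_leP; split => // -[i j] _ /=.
by rewrite (ord1 i).
Qed.

Lemma ball_rVE x r : ball x r = [set y | `|x - y| < r].
Proof. by rewrite -ball_normE. Qed.

Lemma ball_subset x y r r' : `|x - y| + r' <= r -> ball y r' `<=` ball x r.
Proof.
move=> xyr z; rewrite !ball_rVE /= => yz; apply: lt_le_trans xyr.
by rewrite -(subrKA y) (le_lt_trans (ler_normD _ _))// ltrD2l.
Qed.

Lemma rat_row_approx x r : 0 < r -> exists q : 'rV[rat]_d, `|x - map_mx ratr q| < r.
Proof.
move=> r0.
have /choice[q qx] (i : 'I_d) : exists q : rat, `|x 0 i - ratr q| < r.
  have [|q] := @rat_in_itvoo R (x 0 i - r) (x 0 i + r); first lra.
  rewrite in_itv/= => /andP[? ?]; exists q; rewrite ltr_norml; apply/andP; lra.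
exists (\row_i q i); apply/rV_norm_ltP => // i; by rewrite !mxE.
Qed.

End row_vectors.

Section rational_cubes.
Context {R : realType} {d : nat}.

(** Half-open, to match the boxes of [tuple_measure_box], and given by rational data, so that there
    are countably many of them. *)
Definition rat_cube (qk : 'rV[rat]_d * nat) : set 'rV[R]_d :=
  [set x | forall i, x 0 i \in `]ratr (qk.1 0 i) - qk.2.+1%:R^-1,
                                 ratr (qk.1 0 i) + qk.2.+1%:R^-1]].

Lemma open_rat_cubes (U : set 'rV[R]_d) : open U ->
  U = \bigcup_qk (if `[< rat_cube qk `<=` U >] then rat_cube qk else set0).
Proof.
move=> oU; apply/seteqP; split => [x Ux|x [qk _]]; last by case: asboolP => //; exact.
have /nbhs_ballP[e /= e0 eU] : nbhs x U by exact: open_nbhs_nbhs.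
(* The centre will be within [1/(k+1)] of [x] and the cube has half-side [1/(k+1)], hence the bound
   [e / 2]. *)
have [k ke] := ex_natSinv_lt (divr_gt0 e0 (@ltr0Sn R 1)).
have k0 : (0 : R) < k.+1%:R^-1 by rewrite invr_gt0.
have [q qx] := rat_row_approx x k0.
exists (q, k) => //.
have qxi i : `|x 0 i - ratr (q 0 i)| < k.+1%:R^-1.
  by have := rV_norm_ltP _ k0 qx i; rewrite !mxE.
case: asboolP => [_ i /=|[]].
  by have := qxi i; rewrite ltr_distl in_itv/= => /andP[-> /ltW].
move=> y yq; apply: eU; rewrite ball_rVE /=; apply/rV_norm_ltP => // i; rewrite !mxE.
have := yq i; have := qxi i; rewrite /= in_itv/= ltr_distl ltr_norml.
move: ke; set c := (_^-1); move: (ratr _) => z; move: (x _ _) (y _ _) => a b.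
by move=> ? /andP[? ?] /andP[? ?]; apply/andP; lra.
Qed.

Lemma measurable_tuple_open (U : set 'rV[R]_d) : open U ->
  measurable (@row_of_tuple R d @^-1` U).
Proof.
move=> /open_rat_cubes ->; rewrite preimage_bigcup.
apply: countable_bigcupT_measurable => // qk.
case: asboolP => _; last by rewrite preimage_set0.
pose a i : R := ratr (qk.1 0 i) - qk.2.+1%:R^-1.
pose b i : R := ratr (qk.1 0 i) + qk.2.+1%:R^-1.
have [] := @tuple_measure_box R d a b.
  by move=> i; rewrite /a /b lerD2l ge0_cp// invr_ge0.
move=> + _; congr measurable; apply/seteqP; split => t /= tab i; have := tab i; by rewrite !mxE.
Qed.

End rational_cubes.

(** * The Lebesgue measure on row vectors *)

Section lebesgue_rV_basics.
Context {R : realType} {d : nat}.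
Implicit Types (A : set 'rV[R]_d) (x y : 'rV[R]_d) (r : R).
Local Notation mu := (@lebesgue_rV R d).

Lemma ball_le0 x r : r <= 0 -> ball x r = set0.
Proof.
move=> r0; apply/seteqP; split => // y; rewrite ball_rVE /= => /lt_le_trans/(_ r0).
by rewrite ltNge normr_ge0.
Qed.

(** Borel sets of tuples satisfy Caratheodory's condition for [mu_ext], and preimages commute with
    the set operations occurring in it. *)
Lemma lebesgue_rV_tuple A : measurable (@row_of_tuple R d @^-1` A) ->
  measurable A /\ mu A = tuple_measure R d (@row_of_tuple R d @^-1` A).
Proof.
move=> mA; split; last by rewrite /lebesgue_rV /outer_lebesgue measurable_mu_extE.
have cA : ((tuple_measure R d)^*%mu).-cara.-measurable (@row_of_tuple R d @^-1` A).
  by apply: sub_caratheodory; exact: sub_sigma_algebra.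
by move=> X; rewrite /outer_lebesgue !preimage_setI -preimage_setC; exact: cA.
Qed.

Lemma measurable_rV_open A : open A -> measurable A.
Proof. by move=> /measurable_tuple_open /lebesgue_rV_tuple[]. Qed.

Lemma measurable_rV_closed A : closed A -> measurable A.
Proof.
by move=> cA; rewrite -(setCK A); apply: measurableC; exact/measurable_rV_open/closed_openC.
Qed.

Lemma measurable_rV_ball x r : measurable (ball x r).
Proof. 
have [r0|r0] := leP r 0; first by rewrite ball_le0//; exact: measurable0.
exact/measurable_rV_open/ball_open. Qed.

Lemma continuous_rV_measurable (f : 'rV[R]_d -> R) : continuous f ->
  measurable_fun [set: 'rV[R]_d] f.
Proof.
move=> /continuousP cf; apply: (measurability _ (RGenOpens.measurableE R)).
by move=> _ [_ [a [b ->]] <-]; rewrite setTI; apply/measurable_rV_open/cf; exact: interval_open.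
Qed.

Lemma lebesgue_rV_ball_le x r : 0 <= r -> (mu (ball x r) <= ((2 * r) ^+ d)%:E)%E.
Proof.
move=> r0; have [r00|r00] := leP r 0.
  by rewrite ball_le0// measure0 lee_fin exprn_ge0// mulr_ge0.
pose a : 'rV[R]_d := x - const_mx r; pose b : 'rV[R]_d := x + const_mx r.
have ab i : a 0 i <= b 0 i by rewrite !mxE; lra.
have -> : (2 * r) ^+ d = \prod_i (b 0 i - a 0 i).
  rewrite -[in LHS](card_ord d) -prodr_const; apply: eq_bigr => i _; rewrite !mxE; lra.
rewrite -lebesgue_rV_box//; apply: le_outer_measure => y; rewrite ball_rVE /=.
move=> /rV_norm_ltP xy i; have := xy r00 i.
by rewrite !mxE in_itv/= ltr_norml => /andP[? ?]; apply/andP; split; lra.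
Qed.

(** The half-open box of side [2 * r] is in general not inside the open ball, so a box of side [r]
    is used; the factor lost is harmless. *)
Lemma lebesgue_rV_ball_ge x r : 0 < r -> ((r ^+ d)%:E <= mu (ball x r))%E.
Proof.
move=> r0; pose a : 'rV[R]_d := x - const_mx (r / 2); pose b : 'rV[R]_d := x + const_mx (r / 2).
have ab i : a 0 i <= b 0 i by rewrite !mxE; lra.
have -> : r ^+ d = \prod_i (b 0 i - a 0 i).
  rewrite -[in LHS](card_ord d) -prodr_const; apply: eq_bigr => i _; rewrite !mxE; lra.
rewrite -lebesgue_rV_box//; apply: le_outer_measure => y /= yab.
rewrite ball_rVE /=; apply/rV_norm_ltP => // i; have := yab i.
by rewrite !mxE in_itv/= ltr_norml => /andP[? ?]; apply/andP; split; lra.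
Qed.

End lebesgue_rV_basics.


(** * Translations and dilations of the Lebesgue measure *)

Lemma ex_scaled_pushforward d1 d2 (T1 : measurableType d1) (T2 : measurableType d2)
    (R : realType) (m : {measure set T1 -> \bar R}) (phi : T1 -> T2) (r : R) :
  measurable_fun [set: T1] phi -> 0 <= r ->
  exists M : {measure set T2 -> \bar R}, forall A, M A = (r%:E * m (phi @^-1` A))%E.
Proof.
move=> mphi r0.
have [M0 M0E] : exists M : {measure set T2 -> \bar R}, forall A, M A = m (phi @^-1` A).
  unshelve eexists; first by apply: (pushforward m phi : {measure set _ -> \bar R}); exact: mphi.
  by [].
by exists (mscale (NngNum r0) M0) => A; rewrite /= /mscale/= M0E.
Qed.

Section affine_change_of_variables.
Context {R : realType} (r : R) (r0 : 0 < r).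
Local Notation affine := (fun a s : R => a + r * s).

Lemma measurable_affine a :
  measurable_fun [set: measurableTypeR R] (affine a : measurableTypeR R -> measurableTypeR R).
Proof. by apply: measurable_funD => //; exact: measurable_funM. Qed.

(** Both sides are measures in [A], and they agree on the half-open intervals, which determine the
    Lebesgue measure. *)
Lemma lebesgue_measure_affine a (A : set (measurableTypeR R)) : measurable A ->
  lebesgue_measure A = (r%:E * lebesgue_measure (affine a @^-1` A : set (measurableTypeR R)))%E.
Proof.
have [M ME] := ex_scaled_pushforward lebesgue_measure (measurable_affine a) (ltW r0).
move=> mA; rewrite -ME; apply: lebesgue_measure_unique => // _ [[x y] _ <-]; rewrite ME /=.
have -> : affine a @^-1` `]x, y]%classic = `](x - a) / r, (y - a) / r]%classic.
  apply/seteqP; split => s /=; rewrite !in_itv/= ltr_pdivrMr// ler_pdivlMr//;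
    by move=> /andP[? ?]; apply/andP; split; lra.
rewrite !lebesgue_measure_itv/= !lte_fin ltr_pM2r ?invr_gt0// ltrD2r.
case: ifPn => _; last by rewrite mule0.
by rewrite -!EFinB -EFinM; congr (_%:E); rewrite -mulrBl mulrCA mulfV ?gt_eqF// mulr1; ring.
Qed.

Definition tuple_affine n (a t : n.-tuple R) : n.-tuple R :=
  [tuple affine (tnth a i) (tnth t i) | i < n].

Lemma measurable_tuple_affine n (a : n.-tuple R) :
  measurable_fun [set: n.-tuple R] (tuple_affine a).
Proof.
apply/measurable_fun_tnthP => i; rewrite (_ : _ \o _ = fun t => affine (tnth a i) (tnth t i)).
  apply: measurable_funD => //; apply: measurable_funM => //; exact: measurable_tnth.
by apply/funext => t /=; rewrite tnth_mktuple.
Qed.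

(** The map acts separately on head and tail, so the right-hand side agrees with the product measure
    on rectangles, with factors [r] and [r ^ n]; uniqueness of the product measure concludes. *)
Lemma tuple_measure_affine n (a : n.-tuple R) A : measurable A ->
  tuple_measure R n A = ((r ^+ n)%:E * tuple_measure R n (tuple_affine a @^-1` A))%E.
Proof.
elim: n a A => [|n ih] a A mA.
  rewrite expr0 mul1e /=; congr (dirac _ _); apply/seteqP; split => t;
    by rewrite (tuple0 t) /preimage /= (tuple0 (tuple_affine _ _)).
have [a0 [a' ->]] : exists a0 a', a = tcons (a0, a').
  by exists (thead a), [tuple of behead a]; rewrite {1}(tuple_eta a); exact/val_inj.
have tconsE s t : tuple_affine (tcons (a0, a')) (tcons (s, t)) =
                  tcons (affine a0 s, tuple_affine a' t).
  apply/eq_from_tnth => i; rewrite tnth_mktuple.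
  by case: (unliftP ord0 i) => [j ->|->]; rewrite ?tnth0 // !tnthS tnth_mktuple.
pose phi (p : measurableTypeR R * n.-tuple R) : measurableTypeR R * n.-tuple R :=
  (affine a0 p.1, tuple_affine a' p.2).
have mphi : measurable_fun [set: _] phi.
  apply/measurable_fun_pair => /=.
    exact: (measurableT_comp (measurable_affine a0)).
  exact: (measurableT_comp (measurable_tuple_affine a')).
have [M ME] := ex_scaled_pushforward (lebesgue_measure \x tuple_measure R n)%E mphi
  (exprn_ge0 n.+1 (ltW r0)).
have mtA : measurable (@tcons R n @^-1` A).
  by rewrite -[X in measurable X]setTI; exact: measurable_tcons.
rewrite /= /tuple_measureS /pushforward (@product_measure_unique _ _ _ _ _ _ _ M)//.
  rewrite ME; suff -> : phi @^-1` (@tcons R n @^-1` A) =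
      @tcons R n @^-1` (tuple_affine (tcons (a0, a')) @^-1` A) by [].
  by apply/seteqP; split => -[s t] /=; rewrite /phi tconsE.
move=> B C mB mC; rewrite ME.
have -> : phi @^-1` (B `*` C) = (affine a0 @^-1` B) `*` (tuple_affine a' @^-1` C) by [].
have mB' : measurable (affine a0 @^-1` B : set (measurableTypeR R)).
  by rewrite -[X in measurable X]setTI; exact: measurable_affine.
have mC' : measurable (tuple_affine a' @^-1` C).
  by rewrite -[X in measurable X]setTI; exact: measurable_tuple_affine.
have := @product_measure1E _ _ _ _ _ lebesgue_measure (tuple_measure R n) _ _ mB' mC'.
move=> /= ->.
rewrite (lebesgue_measure_affine a0 mB) (ih a' C mC) exprS EFinM.
by rewrite muleACA.
Qed.

End affine_change_of_variables.

Section rV_affine.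
Context {R : realType} {d : nat}.
Implicit Types (A : set 'rV[R]_d) (x y : 'rV[R]_d) (r : R).
Local Notation mu := (@lebesgue_rV R d).
Local Notation affine x r := (fun y => (x + r *: y)%R).

(** Arbitrary sets are treated because Caratheodory's condition tests arbitrary sets. The preimages
    of a measurable cover of [A] cover the preimage of [A], and the measure of each is divided by
    [r ^ d]. *)
Let outer_affine_le x r A : 0 < r ->
  ((r ^+ d)%:E * outer_lebesgue (affine x r @^-1` A) <= outer_lebesgue A)%E.
Proof.
move=> r0; have rd0 : 0 < r ^+ d by rewrite exprn_gt0.
apply: le_ereal_inf_tmp => _ [B [mB AB] <-].
pose a : d.-tuple R := [tuple x 0 i | i < d].
have mB' k : measurable (tuple_affine r a @^-1` B k).
  by rewrite -[X in measurable X]setTI; exact: measurable_tuple_affine.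
rewrite (eq_eseriesr (fun k _ => tuple_measure_affine r0 a (mB k))).
rewrite nneseriesZl; last by [].

rewrite lee_pmul2l//; apply: ereal_inf_lbound.
exists (fun k => tuple_affine r a @^-1` B k) => //; split => // t At.
have [|k _ Bk] := AB (tuple_affine r a t); last by exists k.
rewrite /preimage /=; move: At; rewrite /preimage /=; congr A.
by apply/rowP => i; rewrite !mxE !tnth_mktuple.
Qed.

Lemma affineK x r A : r != 0 ->
  affine (- (r^-1 *: x)) r^-1 @^-1` (affine x r @^-1` A) = A.
Proof.
move=> r0; rewrite -comp_preimage (_ : _ \o _ = id) ?preimage_id//.
by apply/funext => y /=; rewrite scalerDr scalerN !scalerA mulfV// !scale1r addrA subrr add0r.
Qed.

(** The reverse inequality is [outer_affine_le] for the inverse map, applied to the preimage. *)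
Lemma outer_lebesgue_affine x r A : 0 < r ->
  outer_lebesgue A = ((r ^+ d)%:E * outer_lebesgue (affine x r @^-1` A))%E.
Proof.
move=> r0; apply/eqP; rewrite eq_le outer_affine_le// andbT.
have ri0 : 0 < r^-1 by rewrite invr_gt0.
have := outer_affine_le (- (r^-1 *: x)) (affine x r @^-1` A) ri0.
rewrite affineK ?gt_eqF// exprVn => rA.
by rewrite -lee_pdivrMl ?exprn_gt0.
Qed.

Lemma measurable_rV_affine_preimage x r A : 0 < r -> measurable A ->
  measurable (affine x r @^-1` A).
Proof.
move=> r0 mA; set phi := fun y => _.
change (caratheodory_measurable (@outer_lebesgue R d) (phi @^-1` A)) => X.
(* Every test set [X] is the preimage of some [Y]; the condition for the preimage of [A] against [X]
   is then the one for [A] against [Y], divided by [r ^ d]. *)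
have -> : X = phi @^-1` (affine (- (r^-1 *: x)) r^-1 @^-1` X).
  have := affineK (- (r^-1 *: x)) X (invr_neq0 (lt0r_neq0 r0)).
  by rewrite invrK scalerN opprK scalerA mulfV ?gt_eqF// scale1r => ->.
set Y := _ @^-1` X; have := mA Y; rewrite preimage_setC -!preimage_setI.
rewrite (outer_lebesgue_affine x Y r0) (outer_lebesgue_affine x (Y `&` A) r0).
rewrite (outer_lebesgue_affine x (Y `&` ~` A) r0) -muleDr//; last first.
  by rewrite ge0_adde_def// inE outer_measure_ge0.
move/(congr1 (mule (r ^+ d)^-1%:E)).
by rewrite !muleA -EFinM mulVf ?mul1e// expf_neq0// gt_eqF.
Qed.

Lemma measurable_rV_affine x r : 0 < r -> measurable_fun [set: 'rV[R]_d] (affine x r).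
Proof. by move=> r0 _ A mA; rewrite setTI; exact: measurable_rV_affine_preimage. Qed.

Lemma lebesgue_rV_affine x r A : 0 < r -> mu A = ((r ^+ d)%:E * mu (affine x r @^-1` A))%E.
Proof. exact: outer_lebesgue_affine. Qed.

Lemma ge0_integral_rV_translate x (A : set 'rV[R]_d) (h : 'rV[R]_d -> \bar R) :
  measurable A -> measurable_fun A h -> (forall y, 0 <= h y)%E ->
  (\int[mu]_(y in (fun y => (x + y)%R) @^-1` A) h (x + y)%R = \int[mu]_(y in A) h y)%E.
Proof.
move=> mA mh h0; have mphi := measurable_rV_affine x (@ltr01 R).
have phiE : affine x 1 = (fun y => x + y) by apply/funext => y; rewrite scale1r.
rewrite phiE in mphi; transitivity (\int[pushforward mu (fun y => (x + y)%R)]_(y in A) h y)%E.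
  by rewrite (ge0_integral_pushforward mphi).
apply: eq_measure_integral => B mB _.
have := lebesgue_rV_affine x B (@ltr01 R); rewrite expr1n mul1e phiE => muB; exact/esym.
Qed.

End rV_affine.

(** * Fubini's theorem for sets with null slices *)

Section null_slices.
Context {R : realType}.

Definition set_tnth n (t : n.-tuple R) (i : 'I_n) (s : R) : n.-tuple R :=
  [tuple if j == i then s else tnth t j | j < n].

Lemma set_tnth_tcons0 n (s s' : R) (t : n.-tuple R) :
  set_tnth (tcons (s, t)) ord0 s' = tcons (s', t).
Proof.
apply/eq_from_tnth => k; rewrite tnth_mktuple.
by case: (unliftP ord0 k) => [j ->|->]; rewrite ?eqxx ?tnth0 // !tnthS.
Qed.

Lemma set_tnth_tconsS n (s s' : R) (t : n.-tuple R) i :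
  set_tnth (tcons (s, t)) (lift ord0 i) s' = tcons (s, set_tnth t i s').
Proof.
apply/eq_from_tnth => k; rewrite tnth_mktuple.
case: (unliftP ord0 k) => [j ->|->]; last by rewrite !tnth0.
by rewrite !tnthS tnth_mktuple (inj_eq lift_inj).
Qed.

(** For a tail coordinate, the section at a fixed head is null by induction; for the head
    coordinate, the order of integration is exchanged. *)
Lemma null_slices_tuple_measure n (i : 'I_n) (N : set (n.-tuple R)) : measurable N ->
  (forall t, lebesgue_measure ([set s | N (set_tnth t i s)] : set (measurableTypeR R)) = 0%E) ->
  tuple_measure R n N = 0%E.
Proof.
elim: n i N => [|n ih] i N mN N0; first by case: i {N0}.
pose M : set (measurableTypeR R * n.-tuple R) := @tcons R n @^-1` N.
have mM : measurable M by rewrite -[X in measurable X]setTI; exact: measurable_tcons.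
rewrite /= /tuple_measureS /pushforward -/M.
case: (unliftP ord0 i) N0 => [j ->|->] N0.
  rewrite /product_measure1; apply: integral0_eq => s _ /=.
  apply: (ih j); first exact: measurable_xsection.
  move=> t; rewrite -[RHS](N0 (tcons (s, t))); congr (lebesgue_measure _).
  by apply/seteqP; split => u /=; rewrite set_tnth_tconsS /xsection /= inE.
have := @product_measure_unique _ _ _ _ _ lebesgue_measure (tuple_measure R n)
  (product_measure2 lebesgue_measure (tuple_measure R n)).
move=> ->//; last by move=> A B mA mB; rewrite /= product_measure2E.
rewrite /= /product_measure2; apply: integral0_eq => t _ /=.
rewrite -[RHS](N0 (tcons (0, t))); congr (lebesgue_measure _).
by apply/seteqP; split => u /=; rewrite set_tnth_tcons0 /ysection /= inE.
Qed.

Lemma null_slices_lebesgue_rV d (i : 'I_d) (N : set 'rV[R]_d) :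
  measurable (@row_of_tuple R d @^-1` N) ->
  (forall x, lebesgue_measure ([set s | N (x + s *: delta_mx 0 i)] : set (measurableTypeR R)) = 0%E) ->
  lebesgue_rV N = 0%E.
Proof.
move=> mN N0; have [_ ->] := lebesgue_rV_tuple mN.
apply: (null_slices_tuple_measure mN (i := i)) => t.
(* With coordinate [i] set to [0], adding [s] times the basis vector sets it to [s]. *)
pose x : 'rV[R]_d := \row_j (if j == i then 0 else tnth t j).
rewrite -[RHS](N0 x); congr (lebesgue_measure _); apply/seteqP.
suff xE s : row_of_tuple (set_tnth t i s) = x + s *: delta_mx 0 i.
  by split => s /=; rewrite -xE.
apply/rowP => j; rewrite !mxE tnth_mktuple eqxx /=.
by case: eqP => _; rewrite ?mulr1 ?mulr0 ?addr0 ?add0r.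
Qed.

End null_slices.

(** * Outer regularity *)

Lemma ex_lt_cvge (R : realType) (u : (\bar R)^nat) (l e : \bar R) :
  u @ \oo --> l -> (l < e)%E -> exists n, (u n < e)%E.
Proof.
move=> ul le; have : nbhs l [set x | (x < e)%E].
  by apply: open_nbhs_nbhs; split => //; exact: open_ereal_lt_ereal.
by move=> /ul[n _ /(_ n (leqnn n)) ?]; exists n.
Qed.

Section finite_measure_regularity.
Context {R : realType} {d : nat} (nu : {measure set 'rV[R]_d -> \bar R}).
Hypothesis nu_fin : (nu setT < +oo)%E.

Let nuS A B : measurable A -> measurable B -> A `<=` B -> (nu A <= nu B)%E.
Proof. by move=> mA mB AB; apply: le_measure => //; rewrite inE. Qed.

Let nu_lty A : measurable A -> (nu A < +oo)%E.
Proof. by move=> mA; apply: le_lt_trans nu_fin; exact: nuS. Qed.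

(** Two-sided, so as to be stable under complement. [B] is a set of tuples, where the sigma-algebra
    is generated; [U] and [K] are sets of rows, where the topology is. *)
Definition open_closed_approx (B : set (d.-tuple R)) := forall e : R, 0 < e ->
  exists U K : set 'rV[R]_d, [/\ open U, closed K,
    @row_of_tuple R d @^-1` K `<=` B, B `<=` @row_of_tuple R d @^-1` U &
    (nu (U `\` K) <= e%:E)%E].

Lemma open_closed_approxC B : open_closed_approx B -> open_closed_approx (~` B).
Proof.
move=> aB e /aB[U [K [oU cK KB BU UKe]]]; exists (~` K), (~` U); split.
- exact: closed_openC.
- exact: open_closedC.
- by move=> t /= Ut Bt; exact/Ut/BU.
- by move=> t /= Bt Kt; exact/Bt/KB.
- by rewrite setDE setCK setIC -setDE.
Qed.

(** An infinite union of closed sets need not be closed: half of [e] pays for all the differences,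
    the other half for stopping at a finite stage, which continuity from above of the finite measure
    [nu] allows. *)
Lemma open_closed_approx_bigcup (F : (set (d.-tuple R))^nat) :
  (forall k, open_closed_approx (F k)) -> open_closed_approx (\bigcup_k F k).
Proof.
move=> aF e e0.
have ek0 k : 0 < e / 2 / (2 ^ k.+1)%:R by rewrite !divr_gt0// ltr0n expn_gt0.
have /choice[UK UKP] (k : nat) : exists UK : set 'rV[R]_d * set 'rV[R]_d, [/\ open UK.1, closed UK.2,
    @row_of_tuple R d @^-1` UK.2 `<=` F k, F k `<=` @row_of_tuple R d @^-1` UK.1 &
    (nu (UK.1 `\` UK.2) <= (e / 2 / (2 ^ k.+1)%:R)%:E)%E].
  by have [U [K H]] := aF k _ (ek0 k); exists (U, K).
pose U := \bigcup_k (UK k).1; pose K n := \bigcup_(k < n) (UK k).2.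
have oU : open U by apply: bigcup_open => k _; have [] := UKP k.
have cK n : closed (K n).
  by rewrite /K bigcup_mkord; apply: closed_bigsetU => k _; have [] := UKP k.
have mU : measurable U by exact: measurable_rV_open.
have mK n : measurable (K n) by exact: measurable_rV_closed.
have mUk k : measurable (UK k).1 by apply: measurable_rV_open; have [] := UKP k.
have mKk k : measurable (UK k).2 by apply: measurable_rV_closed; have [] := UKP k.
have nuUK : (nu (\bigcap_n (U `\` K n)) <= (e / 2)%:E)%E.
  apply: le_trans (epsilon_trick0 xpredT (ltW (divr_gt0 e0 (@ltr0Sn R 1)))).
  have /le_trans : (nu (\bigcap_n (U `\` K n)) <=
      \sum_(0 <= k <oo) nu ((UK k).1 `\` (UK k).2))%E.
    apply: measure_sigma_subadditive => [k||].
    - exact: measurableD.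
    - by apply: bigcapT_measurable => n; exact: measurableD.
    - move=> x UKx; have [[k _ Ukx] _] := UKx 0%N I.
      exists k => //; split => // Kkx; have [_] := UKx k.+1 I; apply.
      by exists k => //=.
  apply; apply: lee_nneseries => // k _; have [_ _ _ _] := UKP k; exact.
have : (nu \o (fun n => U `\` K n)) x @[x --> \oo] --> nu (\bigcap_n (U `\` K n)).
  apply: nonincreasing_cvg_mu => [|n||m n mn].
  - by apply: nu_lty; exact: measurableD.
  - exact: measurableD.
  - by apply: bigcapT_measurable => n; exact: measurableD.
  - apply/subsetPset; apply: setDS => x [k /= km Kx]; exists k => //=.
    exact: leq_trans mn.
move=> /(@ex_lt_cvge _ _ _ e%:E)[].
  by apply: le_lt_trans nuUK _; rewrite lte_fin; lra.
move=> n /= nue; exists U, (K n); split => //.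
- move=> t [k _ Kt]; exists k => //; have [_ _ KF _ _] := UKP k; exact: KF.
- move=> t [k _ Ft]; exists k => //; have [_ _ _ FU _] := UKP k; exact: FU.
- exact: ltW.
Qed.

(** The open slabs overshoot [b] by [1/(n+1)] and the closed ones start [1/(n+1)] after [a]; their
    differences decrease to the empty set. *)
Lemma open_closed_approx_itv i (a b : R) :
  open_closed_approx [set t | tnth t i \in `]a, b]].
Proof.
move=> e e0.
pose U n := [set x : 'rV[R]_d | a < x 0 i < b + n.+1%:R^-1].
pose K n := [set x : 'rV[R]_d | a + n.+1%:R^-1 <= x 0 i <= b].
have ci : continuous (fun x : 'rV[R]_d => x 0 i) by exact: coord_continuous.
have oU n : open (U n).
  rewrite (_ : U n = (fun x : 'rV[R]_d => x 0 i) @^-1` `]a, b + n.+1%:R^-1[%classic).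
    by apply: open_comp => [x _|]; [exact: ci|exact: interval_open].
  by apply/seteqP; split => x /=; rewrite in_itv.
have cK n : closed (K n).
  rewrite (_ : K n = (fun x : 'rV[R]_d => x 0 i) @^-1` `[a + n.+1%:R^-1, b]%classic).
    by apply: preimage_closed => //; exact: interval_closed.
  by apply/seteqP; split => x /=; rewrite in_itv.
have mUK n : measurable (U n `\` K n).
  by apply: measurableD; [exact: measurable_rV_open|exact: measurable_rV_closed].
have UK0 : \bigcap_n (U n `\` K n) = set0.
  apply/seteqP; split => // x UKx.
  have ax : a < x 0 i by have [/andP[]] := UKx 0%N I.
  have xb : x 0 i <= b.
    apply/ler_addgt0Pr => eps eps0.
    have [n neps] := ex_natSinv_lt eps0.
    have [/andP[_ /ltW xn] _] := UKx n I.
    by apply: (le_trans xn); rewrite lerD2l ltW.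
  have xa0 : 0 < x 0 i - a by rewrite subr_gt0.
  have [n neps] := ex_natSinv_lt xa0.
  by have [_] := UKx n I; apply; rewrite /K /= xb andbT -lerBrDl ltW.
have : (nu \o (fun n => U n `\` K n)) x @[x --> \oo] --> nu (\bigcap_n (U n `\` K n)).
  apply: nonincreasing_cvg_mu => [|k||m k mn].
  - exact: nu_lty.
  - exact: mUK.
  - by rewrite UK0.
  - have mn1 : k.+1%:R^-1 <= m.+1%:R^-1 :> R by rewrite lef_pV2 ?posrE// ler_nat.
    apply/subsetPset => x [/= /andP[ax xb] Kx]; split => /=.
      by rewrite /U /= ax/= (lt_le_trans xb)// lerD2l.
    by move=> /andP[ax' xb']; apply: Kx; rewrite /K /= xb' andbT (le_trans _ ax')// lerD2l.
rewrite UK0 measure0 => /(@ex_lt_cvge _ _ _ e%:E)[]; first by rewrite lte_fin.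
move=> n /= nue; have n0 : 0 < n.+1%:R^-1 :> R by rewrite invr_gt0.
exists (U n), (K n); split => //; last exact: ltW.
- by move=> t; rewrite /K/= mxE in_itv/= => /andP[ax ->]; rewrite andbT (lt_le_trans _ ax)// ltrDl.
- by move=> t; rewrite /U/= mxE in_itv/= => /andP[-> xb] /=; rewrite (le_lt_trans xb)// ltrDl.
Qed.

Lemma measurable_open_closed_approx B : measurable B -> open_closed_approx B.
Proof.
have approx0 : open_closed_approx set0.
  move=> e e0; exists set0, set0; split; [exact: open0|exact: closed0|by []|by []|].
  by rewrite setD0 measure0 lee_fin ltW.
(* The approximable sets form a sigma-algebra. The generators are preimages of measurable sets under
   one coordinate, which the same argument reduces to half-open intervals. *)
apply: smallest_sub B.
  split => //; last exact: open_closed_approx_bigcup.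
  by move=> A /open_closed_approxC; rewrite setTD.
apply: (big_ind (fun G => G `<=` open_closed_approx)) => // [A B A1 B1|i _].
  by rewrite subUset.
move=> _ [B mB <-]; rewrite setTI.
apply: (@smallest_sub _ (sigma_algebra setT) (@ocitv R)
  [set B | open_closed_approx ((fun t => tnth t i) @^-1` B)]) => //.
  split; first by rewrite /= preimage_set0.
  - by move=> A /= /open_closed_approxC; rewrite setTD preimage_setC.
  - by move=> F /= aF; rewrite preimage_bigcup; exact: open_closed_approx_bigcup.
by move=> _ [[a b] _ <-]; exact: open_closed_approx_itv.
Qed.

End finite_measure_regularity.

Section outer_regularity.
Context {R : realType} {d : nat}.
Local Notation mu := (@lebesgue_rV R d).

(** The measure is finite on each cube [Q n]; cutting the open set found there by [Q n] makes the
    errors [e / 2 ^ (n+1)] summable. *)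
Let Borel_outer_regular (B : set 'rV[R]_d) (e : R) :
  measurable (@row_of_tuple R d @^-1` B) -> 0 < e ->
  exists V, [/\ open V, B `<=` V & (mu V <= mu B + e%:E)%E].
Proof.
move=> mtB e0; have [mB _] := lebesgue_rV_tuple mtB.
pose Q n : set 'rV[R]_d := ball 0 n.+1%:R.
have oQ n : open (Q n) by apply: ball_open.
have mQ n : measurable (Q n) by exact: measurable_rV_ball.
have ek0 k : 0 < e / (2 ^ k.+1)%:R by rewrite !divr_gt0// ltr0n expn_gt0.
have /choice[U UP] (n : nat) : exists U, [/\ open U, B `<=` U &
    (mu ((U `\` B) `&` Q n) <= (e / (2 ^ n.+1)%:R)%:E)%E].
  have fin : (mrestr mu (mQ n) setT < +oo)%E.
    rewrite /mrestr setTI; apply: le_lt_trans (ltry _).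
    by apply: lebesgue_rV_ball_le; rewrite ler0n.
  have [U [K [oU cK KB BU UK]]] := measurable_open_closed_approx fin mtB (ek0 n).
  have BUU : B `<=` U.
    move=> x Bx; have xE : x = row_of_tuple [tuple x 0 i | i < d].
      by apply/rowP => i; rewrite !mxE tnth_mktuple.
    by rewrite xE; apply: BU; rewrite /preimage /= -xE.
  have KBB : K `<=` B.
    move=> x Kx; have xE : x = row_of_tuple [tuple x 0 i | i < d].
      by apply/rowP => i; rewrite !mxE tnth_mktuple.
    by rewrite xE; apply: KB; rewrite /preimage /= -xE.
  exists U; split => //; apply: le_trans UK.
  by apply: le_outer_measure; apply: setSI; exact: setDS.
pose V := \bigcup_n (U n `&` Q n); exists V.
have mU n : measurable (U n) by apply: measurable_rV_open; have [] := UP n.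
have BV : B `<=` V.
  move=> x Bx; have [n xn] : exists n : nat, `|x| < n.+1%:R.
    by exists (Num.truncn `|x|); exact: truncnS_gt.
  exists n => //; split; first by have [_] := UP n; move=> + _; exact.
  by rewrite /Q ball_rVE /= sub0r normrN.
split => //; first by apply: bigcup_open => n _; apply: openI => //; have [] := UP n.
have mV : measurable V by apply: bigcupT_measurable => n; exact: measurableI.
rewrite -[V](setDUK BV) measureU//; last 2 first.
- exact: measurableD.
- by rewrite setDE setICA setICr setI0.
apply: leeD => //; apply: le_trans (epsilon_trick0 xpredT (ltW e0)).
apply: (@le_trans _ _ (\sum_(0 <= k <oo) mu ((U k `\` B) `&` Q k))%E).
  apply: measure_sigma_subadditive => [k||].
  - by apply: measurableI => //; exact: measurableD.
  - exact: measurableD.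
  - by move=> x [[k _ [Ux Qx]] Bx]; exists k.
by apply: lee_nneseries => // k _; have [_ _] := UP k.
Qed.

(** A cover by Borel sets realising the outer measure up to [e / 2] reduces the claim to Borel sets,
    which share the other half of [e]. *)
Lemma lebesgue_rV_outer_regular (A : set 'rV[R]_d) (e : R) : 0 < e ->
  exists V, [/\ open V, A `<=` V & (mu V <= mu A + e%:E)%E].
Proof.
move=> e0; have [Afin|] := ltP (mu A) +oo%E; last first.
  by rewrite leye_eq => /eqP ->; exists setT; split => //; [exact: openT|rewrite leey].
have e20 : 0 < e / 2 by lra.
have [_ [/= B [mB AB] <-] Be] : exists2 z, [set (\sum_(k <oo) tuple_measure R d (B k))%E |
    B in measurable_cover (@row_of_tuple R d @^-1` A)] z & (z < mu A + (e / 2)%:E)%E.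
  apply: ereal_inf_lt; change (mu A < mu A + (e / 2)%:E)%E.
  by rewrite lteDl ?lte_fin// ge0_fin_numE.
pose tup (x : 'rV[R]_d) : d.-tuple R := [tuple x 0 i | i < d].
have row_tup x : row_of_tuple (tup x) = x by apply/rowP => i; rewrite !mxE tnth_mktuple.
have tup_row t : tup (row_of_tuple t) = t by apply/eq_from_tnth => i; rewrite tnth_mktuple mxE.
have BE k : @row_of_tuple R d @^-1` (tup @^-1` B k) = B k.
  by apply/seteqP; split => t; rewrite /preimage/= tup_row.
have mrB k : measurable (@row_of_tuple R d @^-1` (tup @^-1` B k)) by rewrite BE.
have ek0 k : 0 < e / 2 / (2 ^ k.+1)%:R by rewrite !divr_gt0// ltr0n expn_gt0.
have /choice[V VP] k := Borel_outer_regular (mrB k) (ek0 k).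
exists (\bigcup_k V k); split.
- by apply: bigcup_open => k _; have [] := VP k.
- move=> x Ax; have [|k _ Bk] := AB (tup x); first by rewrite /preimage /= row_tup.
  by exists k => //; have [_ + _] := VP k; exact.
- rewrite (splitr e) EFinD addeA; apply: le_trans (leeD (ltW Be) (lexx _)).
  apply: le_trans (epsilon_trick _ _ (ltW e20)) => //.
  apply: (@le_trans _ _ (\sum_(0 <= k <oo) mu (V k))%E).
    exact: outer_measure_sigma_subadditive.
  apply: lee_nneseries => // k _; have [_ _] := VP k.
  by have [_ ->] := lebesgue_rV_tuple (mrB k); rewrite BE.
Qed.

End outer_regularity.

(** * Differentiation of integrals at the points of a zero set *)

Lemma ex_max_seq (R : realType) (I : eqType) (r : I -> R) (s : seq I) : s <> [::] ->
  exists2 i, i \in s & forall j, j \in s -> r j <= r i.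
Proof.
elim: s => // i [|k s] ih _; first by exists i; rewrite ?inE// => j; rewrite inE => /eqP ->.
have [//|j js jmax] := ih; have [ij|ji] := leP (r i) (r j).
  by exists j => [|l]; rewrite in_cons ?js ?orbT// => /predU1P[-> //|/jmax].
exists i; rewrite ?mem_head// => l; rewrite in_cons => /predU1P[-> //|/jmax lj].
exact: le_trans lj (ltW ji).
Qed.

Section vitali_covering.
Context {R : realType} {d : nat} {I : eqType} (c : I -> 'rV[R]_d) (r : I -> R).
Hypothesis r_gt0 : forall i, 0 < r i.
Local Notation B := (fun i => ball (c i) (r i)).

(** Greedy choice: a ball of maximal radius absorbs, once enlarged three times, every ball that it
    meets. The others form a shorter list, since the chosen ball meets itself. *)
Lemma vitali_finite_rV (s : seq I) : exists D : seq I,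
  [/\ uniq D, {subset D <= s}, trivIset [set` D] B &
  forall i x, i \in s -> B i x -> exists2 j, j \in D & ball (c j) (3 * r j) x].
Proof.
have [n] := ubnP (size s); elim: n s => // n ih s sn.
have [->|/eqP s0] := eqVneq s [::]; first by exists [::]; split.
have [i is_ imax] := ex_max_seq r s0.
pose s' := [seq j <- s | `[< B i `&` B j = set0 >]].
have ii : B i `&` B i <> set0.
  by rewrite setIid => /seteqP[+ _] => /(_ (c i)); apply; exact: ballxx.
have [|D [uD Ds' tD cov]] := ih s'.
  rewrite -ltnS (leq_trans _ sn)// size_filter ltnS -(count_predT s).
  rewrite -[X in (_ < X)%N](count_predC (fun j => `[< B i `&` B j = set0 >])) -addn1 leq_add2l.
  by rewrite -has_count; apply/hasP; exists i => //=; apply/asboolP.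
have iD j : j \in D -> B i `&` B j = set0.
  by move=> /Ds'; rewrite mem_filter => /andP[/asboolP].
exists (i :: D); split.
- by rewrite /= uD andbT; apply/negP => /iD.
- move=> j; rewrite in_cons => /predU1P[-> //|/Ds'].
  by rewrite mem_filter => /andP[].
- move=> j k /=; rewrite !in_cons => /predU1P[->|jD] /predU1P[->|kD] //.
  + by rewrite iD// => /set0P; rewrite eqxx.
  + by rewrite setIC iD// => /set0P; rewrite eqxx.
  + exact: tD.
- move=> j x js Bjx; have [Bij|Bij] := pselect (B i `&` B j = set0).
    have [|k kD Bk] := cov j x _ Bjx; first by rewrite mem_filter js andbT; exact/asboolP.
    by exists k => //; rewrite in_cons kD orbT.
  exists i; first by rewrite mem_head.
  have [y [Biy Bjy]] : B i `&` B j !=set0 by exact/set0P/eqP.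
  move: Biy Bjy Bjx; rewrite !ball_rVE /= => iy jy jx.
  have rji := imax j js.
  have -> : c i - x = (c i - y) - (c j - y) + (c j - x).
    by apply/rowP => l; rewrite !mxE; ring.
  rewrite (le_lt_trans (ler_normD _ _))// (le_lt_trans (lerD (ler_normB _ _) (lexx _)))//.
  lra.
Qed.

End vitali_covering.

Lemma ge0_integral_abs_continuous d (T : measurableType d) (R : realType)
    (mu : {measure set T -> \bar R}) (h : T -> \bar R) (D : set T) (e : R) :
  measurable D -> measurable_fun D h -> (forall x, 0 <= h x)%E ->
  (\int[mu]_(x in D) h x < +oo)%E -> 0 < e ->
  exists2 dlt, 0 < dlt & forall A, measurable A -> A `<=` D -> (mu A < dlt%:E)%E ->
    (\int[mu]_(x in A) h x <= e%:E)%E.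
Proof.
move=> mD mh h0 hD e0.
have inth : mu.-integrable D h.
  by apply/integrableP; split => //; under eq_integral do rewrite gee0_abs//.
have aeh := integrable_ae mD inth.
(* [h] may be infinite on a null set; the real-valued [f] represents it. *)
pose f := fine \o (h \_ D).
have mhD : measurable_fun setT (h \_ D) by exact/(measurable_restrictT _ _).1.
have mf : measurable_fun setT f by exact: measurableT_comp.
have mnf : measurable_fun setT (fun x => `|f x|%:E) by apply/measurable_EFinP; exact: measurableT_comp.
have hf : {ae mu, forall x, D x -> h x = (f x)%:E}.
  apply: filterS aeh => x hx Dx; rewrite /f /= patchE mem_set// fineK//; exact: hx.
have f0 x : 0 <= f x by apply: fine_ge0; apply: erestrict_ge0 => y _.
have intf : mu.-integrable setT (EFin \o f).
  apply/integrableP; split; first exact/measurable_EFinP.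
  apply: le_lt_trans hD; rewrite [leRHS]integral_mkcond.
  apply: ge0_le_integral => //.
  - move=> x _; rewrite /= ger0_norm//.
    have : (0 <= (h \_ D) x)%E by exact: erestrict_ge0.
    by rewrite /f /=; case: ((h \_ D) x) => //= _; rewrite leey.
have [dlt [dlt0 H]] := integral_normr_continuous intf e0.
exists dlt => // A mA AD /(H A mA) /ltW; rewrite -lee_fin; apply: le_trans.
rewrite /Rintegral fineK; last first.
  rewrite ge0_fin_numE; last by apply: integral_ge0 => x _; rewrite lee_fin.
  have /integrableP[_] := intf; apply: le_lt_trans.
  exact: ge0_subset_integral.
rewrite (@ge0_ae_eq_integral _ _ _ _ _ h (fun x => `|f x|%:E))//.
- exact: measurable_funS mh.
- exact: measurable_funTS.
- by apply: filterS hf => x hx Ax; rewrite hx ?ger0_norm//; exact: AD.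
Qed.

Lemma ge0_sum_integral_le d (T : measurableType d) (R : realType)
    (mu : {measure set T -> \bar R}) (h : T -> \bar R) (U : set T)
    (I : eqType) (F : I -> set T) (s : seq I) :
  measurable U -> measurable_fun U h -> (forall x, 0 <= h x)%E ->
  (forall i, measurable (F i)) -> uniq s -> trivIset [set` s] F ->
  (forall i, i \in s -> F i `<=` U) ->
  (\sum_(i <- s) \int[mu]_(x in F i) h x <= \int[mu]_(x in U) h x)%E.
Proof.
move=> mU mh h0 mF us tF FU.
have DU : \big[setU/set0]_(i <- s) F i `<=` U.
  by rewrite big_seq; apply: (big_ind (fun A => A `<=` U)) => // A B AU BU x [/AU|/BU].
have mD : measurable (\big[setU/set0]_(i <- s) F i) by exact: bigsetU_measurable.
rewrite -ge0_integral_bigsetU//; last exact: measurable_funS mh.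
exact: ge0_subset_integral.
Qed.

Section differentiation_at_zero_set.
Context {R : realType} {d : nat}.
Local Notation mu := (@lebesgue_rV R d).

Lemma lebesgue_rV_negligible (Z : set 'rV[R]_d) : (mu Z <= 0)%E -> mu.-negligible Z.
Proof.
move=> Z0; suff mZ : measurable Z by exists Z; split => //; apply/eqP; rewrite -measure_le0.
change (caratheodory_measurable (@outer_lebesgue R d) Z).
apply: le_caratheodory_measurable => X.
rewrite -[leRHS]add0e; apply: leeD; last by apply: le_outer_measure; exact: subIsetl.
by apply: le_trans Z0; apply: le_outer_measure; exact: subIsetr.
Qed.

(** A weak-type estimate. Continuity from below reduces it to finitely many balls, from which
    disjoint ones are selected; [6] is the enlargement factor [3] times the ratio [2] of the side of
    a cube to its radius. *)
Lemma vitali_integral_bound (h : 'rV[R]_d -> \bar R) (U : set 'rV[R]_d)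
    (c : nat -> 'rV[R]_d) (r : nat -> R) (P : pred nat) (e : R) :
  measurable U -> measurable_fun U h -> (forall x, 0 <= h x)%E -> 0 < e ->
  (forall n, P n -> [/\ 0 < r n, ball (c n) (r n) `<=` U &
    ((e * r n ^+ d)%:E <= \int[mu]_(x in ball (c n) (r n)) h x)%E]) ->
  (e%:E * mu (\bigcup_(n in P) ball (c n) (r n)) <= (6 ^+ d)%:E * \int[mu]_(x in U) h x)%E.
Proof.
(* The value [1] outside [P] makes all radii positive, as the covering lemma requires. *)
move=> mU mh h0 e0 HP; pose r' n := if P n then r n else 1.
have r'0 n : 0 < r' n by rewrite /r'; case: ifPn => // /HP[].
pose G n := \bigcup_(k in [set k | P k /\ (k < n)%N]) ball (c k) (r' k).
have mB n : measurable (ball (c n) (r' n)) by exact: measurable_rV_ball.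
have mG n : measurable (G n).
  by apply: bigcup_measurable => k _.
have UG : \bigcup_(n in P) ball (c n) (r n) = \bigcup_n G n.
  apply/seteqP; split => x.
    by move=> [n Pn Bx]; exists n.+1 => //; exists n; rewrite /= ?ltnSn// /r' Pn.
  by move=> [n _ [k /= [Pk _]]]; rewrite /r' Pk => ?; exists k.
have mUG : measurable (\bigcup_n G n) by exact: bigcupT_measurable.
have : (mu \o G) x @[x --> \oo] --> mu (\bigcup_n G n).
  apply: nondecreasing_cvg_mu => // m n mn; apply/subsetPset => x [k [Pk km] Bx].
  by exists k => //; split => //; exact: leq_trans mn.
rewrite -UG -lee_pdivlMl// => Gcvg.
rewrite -(cvg_lim _ Gcvg)//; apply: lime_le; first by apply/cvg_ex; eexists; exact: Gcvg.
apply: nearW => n; rewrite /= lee_pdivlMl//.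
have [D [uD Ds tD cov]] := vitali_finite_rV c r'0 [seq k <- iota 0 n | P k].
have PD j : j \in D -> P j by move=> /Ds; rewrite mem_filter => /andP[].
have GD : (mu (G n) <= \sum_(j <- D) ((6 * r' j) ^+ d)%:E)%E.
  apply: (@le_trans _ _ (mu (\big[setU/set0]_(j <- D) ball (c j) (3 * r' j)))).
    apply: le_outer_measure => x [k [Pk kn] Bkx].
    have [|j jD Bj] := cov k x _ Bkx; first by rewrite mem_filter Pk mem_iota.
    by rewrite -bigcup_seq; exists j.
  apply: (@le_trans _ _ (\sum_(j <- D) mu (ball (c j) (3 * r' j)))%E).
    elim: D {uD Ds tD cov PD} => [|j D ih]; first by rewrite !big_nil measure0.
    by rewrite !big_cons; apply: le_trans (outer_measureU2 _ _ _) _; exact: leeD2l.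
  apply: lee_sum => j _; rewrite (_ : 6 * r' j = 2 * (3 * r' j)); last by ring.
  by apply: lebesgue_rV_ball_le; rewrite mulr_ge0// ltW.
apply: le_trans (lee_pmul (ltW _) _ (lexx _) GD) _ => //.
rewrite sumEFin -EFinM mulr_sumr -sumEFin.
apply: (@le_trans _ _ ((6 ^+ d)%:E * \sum_(j <- D) \int[mu]_(x in ball (c j) (r' j)) h x)%E).
  rewrite ge0_sume_distrr; last by move=> j _; apply: integral_ge0 => x _.
  rewrite big_seq [leRHS]big_seq; apply: lee_sum => j /PD Pj.
  have [_ _ hj] := HP j Pj; rewrite /r' Pj exprMn mulrCA EFinM.
  by apply: lee_pmul => //; rewrite lee_fin ?mulr_ge0 ?exprn_ge0// ltW//; have [] := HP j Pj.
rewrite lee_pmul2l ?exprn_gt0//.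
apply: ge0_sum_integral_le => // j /PD Pj.
by rewrite /r' Pj; have [] := HP j Pj.
Qed.

Local Notation cube N := (ball (0 : 'rV[R]_d)%R (N.+1%:R)%R).

(* The balls of the family in the Vitali bound have rational centres and radii, hence are
   countably many: an arbitrary bad ball is enlarged by a factor at most 2, which costs [2 ^ d]. *)
Let bad_points_null (h : 'rV[R]_d -> \bar R) (A : set 'rV[R]_d) (N : nat) (e : R) :
  measurable_fun setT h -> (forall x, 0 <= h x)%E -> measurable A ->
  (\int[mu]_(x in cube N) h x < +oo)%E -> (forall x, A x -> h x = 0%E) -> 0 < e ->
  mu.-negligible [set x | [/\ A x, cube N x & forall dlt, 0 < dlt ->
    exists r, [/\ 0 < r, r < dlt & ((e * r ^+ d)%:E < \int[mu]_(y in ball x r) h y)%E]]].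
Proof.
move=> mh h0 mA hN hA0 e0; set Z := [set x | _].
pose Q : set 'rV[R]_d := cube N; pose A' := A `&` Q.
have mQ : measurable Q by exact: measurable_rV_ball.
have mA' : measurable A' by exact: measurableI.
pose e1 := e / 2 ^+ d; have e10 : 0 < e1 by rewrite divr_gt0// exprn_gt0.
have A'fin : (mu A' < +oo)%E.
  apply: (@le_lt_trans _ _ (mu Q)); first by apply: le_outer_measure; exact: subIsetr.
  by apply: le_lt_trans (ltry _); apply: lebesgue_rV_ball_le; rewrite ler0n.
suff Zeta (eta : R) : 0 < eta -> (e1%:E * mu Z <= (6 ^+ d * eta)%:E)%E.
  apply: lebesgue_rV_negligible; apply/lee_addgt0Pr => eps eps0; rewrite add0e.
  have eta1 : 0 < e1 * eps / 6 ^+ d by rewrite divr_gt0 ?mulr_gt0// exprn_gt0.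
  have := Zeta _ eta1; have -> : 6 ^+ d * (e1 * eps / 6 ^+ d) = e1 * eps.
    by rewrite mulrCA mulfV ?mulr1// expf_neq0.
  by rewrite -lee_pdivlMl// -EFinM mulKf// gt_eqF.
(* As [h] vanishes on [A'], its integral over an open [U] containing [A'] is the one over the
   difference, at most [eta] once this difference has measure below [dlt]. *)
move=> eta0; have [dlt dlt0 Hdlt] := ge0_integral_abs_continuous mQ
  (measurable_funTS mh) h0 hN eta0.
have dlt20 : 0 < dlt / 2 by lra.
have [V [oV A'V muV]] := lebesgue_rV_outer_regular A' dlt20.
pose U := V `&` Q.
have oU : open U by apply: openI => //; exact: ball_open.
have mV : measurable V by exact: measurable_rV_open.
have mU : measurable U by exact: measurable_rV_open.
have A'U : A' `<=` U by move=> x A'x; split; [exact: A'V|case: A'x].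
have hU : (\int[mu]_(x in U) h x <= eta%:E)%E.
  rewrite -(setDUK A'U) ge0_integral_setU//; last 3 first.
  - exact: measurableD.
  - by apply: measurable_funTS.
  - by rewrite disj_set2E setDE setICA setICr setI0.
  rewrite integral0_eq ?add0e; last by move=> x [Ax _]; exact: hA0.
  apply: Hdlt; first exact: measurableD.
    by move=> x [[]].
  apply: (@le_lt_trans _ _ (mu (V `\` A'))).
    by apply: le_outer_measure; apply: setSD; exact: subIsetl.
  rewrite measureD//; last first.
    by apply: le_lt_trans muV _; rewrite lte_add_pinfty// ltry.
  rewrite setIidr// lteBlDl ?ge0_fin_numE//.
  by apply: le_lt_trans muV _; rewrite lteD2lE ?ge0_fin_numE// lte_fin; lra.
(* A number that codes no pair yields the radius [0], which [P] rejects. *)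
pose qs (n : nat) : 'rV[rat]_d * rat := odflt (0, 0) (unpickle n).
pose c n : 'rV[R]_d := map_mx ratr (qs n).1; pose r n : R := ratr (qs n).2.
pose P n := `[< [/\ 0 < r n, ball (c n) (r n) `<=` U &
    ((e1 * r n ^+ d)%:E <= \int[mu]_(x in ball (c n) (r n)) h x)%E] >].
have := @vitali_integral_bound h U c r P e1 mU (measurable_funTS mh) h0 e10
  (fun n => @asboolW _).
move=> /le_trans/(_ _)/(le_trans _); apply; last first.
  by rewrite EFinM lee_pmul2l ?exprn_gt0.
rewrite lee_pmul2l//; apply: le_outer_measure => x [Ax Qx Zx].
have /nbhs_ballP[rho /= rho0 rhoU] : nbhs x U.
  by apply: open_nbhs_nbhs; split => //; exact: A'U.
have [s [s0 srho hs]] := Zx _ (divr_gt0 rho0 (@ltr0Sn R 3)).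
(* A centre within [t - s] of [x] makes the ball of radius [t] contain the ball of radius [s] around
   [x], and stay within [2 * t - s < 3 * s < rho] of [x]. *)
have [|t] := @rat_in_itvoo R s (2 * s); first lra.
rewrite in_itv/= => /andP[st ts].
have st0 : 0 < ratr t - s by lra.
have [q qx] := rat_row_approx x st0.
have qsE : qs (pickle (q, t)) = (q, t) by rewrite /qs pickleK.
have cE : c (pickle (q, t)) = map_mx ratr q by rewrite /c qsE.
have rE : r (pickle (q, t)) = ratr t by rewrite /r qsE.
exists (pickle (q, t)); last by rewrite ball_rVE /= cE rE distrC; lra.
apply/asboolP; rewrite cE rE; split; first lra.
  by apply: subset_trans rhoU; apply: ball_subset; lra.
apply: (@le_trans _ _ (e * s ^+ d)%:E).
  rewrite lee_fin /e1 -mulrA ler_pM2l// mulrC ler_pdivrMr ?exprn_gt0// -exprMn mulrC.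
  have t0 : (0 : R) <= ratr t by exact/ltW/(lt_trans s0 st).
  have s20 : 0 <= 2 * s by rewrite mulr_ge0// ltW.
  by apply: lerXn2r; rewrite ?nnegrE// ltW.
apply: (le_trans (ltW hs)); apply: ge0_subset_integral => //.
- exact: measurable_rV_ball.
- exact: measurable_rV_ball.
- exact: measurable_funTS.
- by apply: ball_subset; rewrite distrC; lra.
Qed.

Theorem lebesgue_differentiation_zero_set (h : 'rV[R]_d -> \bar R) (A : set 'rV[R]_d) :
  measurable_fun setT h -> (forall x, 0 <= h x)%E -> measurable A ->
  (forall N : nat, (\int[mu]_(x in cube N) h x < +oo)%E) -> (forall x, A x -> h x = 0%E) ->
  {ae mu, forall x, A x -> forall e : R, 0 < e -> exists2 dlt : R, 0 < dlt &
    forall r, 0 < r -> r < dlt -> (\int[mu]_(y in ball x r) h y <= (e * r ^+ d)%:E)%E}.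
Proof.
move=> mh h0 mA hN hA0.
have H (N m : nat) : {ae mu, forall x, ~ [/\ A x, cube N x & forall dlt, 0 < dlt ->
    exists r, [/\ 0 < r, r < dlt & ((m.+1%:R^-1 * r ^+ d)%:E < \int[mu]_(y in ball x r) h y)%E]]}.
  have m0 : 0 < m.+1%:R^-1 :> R by rewrite invr_gt0.
  by apply: negligibleS (bad_points_null mh h0 mA (hN N) hA0 m0) => x /= /contrapT.
have {}H := ae_foralln (fun N => ae_foralln (fun m => H N m)).
apply: filterS H => x Hx Ax e e0; have [m me] := ex_natSinv_lt e0.
apply: contrapT => bad; apply: (Hx (Num.truncn `|x|) m); split => //.
  by rewrite ball_rVE /= sub0r normrN; exact: truncnS_gt.
move=> dlt dlt0; apply: contrapT => nor; apply: bad; exists dlt => // r r0 rdlt.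
rewrite leNgt; apply/negP => er; apply: nor; exists r; split => //.
by apply: le_lt_trans er; rewrite lee_fin ler_pM2r ?exprn_gt0// ltW.
Qed.

End differentiation_at_zero_set.

(** * Rademacher's theorem *)

(* If [h] is [K]-Lipschitz then [h + K id] is nondecreasing and its Stieltjes measure is at most
   [2 K] times the Lebesgue measure; [h] is then recovered from the Radon-Nikodym density. *)
Section lipschitz_derivable.
Context {R : realType} (K : R) (h : R -> R).
Hypothesis K0 : 0 < K.
Hypothesis hK : forall x y, `|h x - h y| <= K * `|x - y|.
Local Notation lambda := (@lebesgue_measure R).

Definition lip_cumulative (x : R) : R := h x + K * x.
Local Notation G := lip_cumulative.

Let G_nd : {homo G : x y / x <= y}.
Proof.
move=> x y xy; have := hK x y; rewrite (ler0_norm (_ : x - y <= 0)) ?subr_le0//.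
rewrite ler_norml => /andP[_]; rewrite /G; lra.
Qed.

Let h_continuous : continuous h.
Proof.
move=> x; apply/cvgrPdist_le => e e0; near=> y.
apply: (le_trans (hK _ _)); rewrite -ler_pdivlMl//.
near: y; apply: cvgr_dist_le; first exact: cvg_id.
by rewrite mulr_gt0// invr_gt0.
Unshelve. all: by end_near. Qed.

Let G_rc : right_continuous G.
Proof.
apply: right_continuousW => x; apply: cvgD; first exact: h_continuous.
by apply: cvgMr; exact: cvg_id.
Qed.

HB.instance Definition _ := isCumulative.Build R _ R G G_nd G_rc.

Let nu := lebesgue_stieltjes_measure (G : cumulative R R).

(** The increment of [G] over an interval is at most [2 * K] times its length, one [K] from [h] and
    one from the linear term; the comparison passes to covers. *)
Let nu_le (A : set (measurableTypeR R)) : (nu A <= (2 * K)%:E * lambda A)%E.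
Proof.
rewrite -lee_pdivrMl ?mulr_gt0//; apply: le_ereal_inf_tmp => _ [B [mB AB] <-].
rewrite lee_pdivrMl ?mulr_gt0// -nneseriesZl; last first.
  by move=> k _; apply: wlength_ge0.
apply: (@le_trans _ _ (\sum_(k <oo) wlength (G : cumulative R R) (B k))%E).
  by apply: ereal_inf_lbound; exists B.
apply: lee_nneseries => [k _ _|k _]; first exact: wlength_ge0.
have /ocitvP[->|[[a b] /= ab ->]] := mB k.
  by rewrite wlength0 [X in (_ * X)%E](wlength0 (idfun : R -> R)) mule0.
rewrite !wlength_itv_bnd ?(ltW ab)// -EFinM lee_fin /= /G.
have := hK b a; rewrite (gtr0_norm (_ : 0 < b - a)) ?subr_gt0// ler_norml => /andP[_]; lra.
Qed.

Let nu_itv a b : a <= b -> nu `]a, b]%classic = (G b - G a)%:E.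
Proof.
move=> ab; rewrite -(wlength_itv_bnd G false false ab)//.
by rewrite /nu /lebesgue_stieltjes_measure/= /measure_extension/= measurable_mu_extE//; exact: is_ocitv.
Qed.

Let ae_derivable_itv (n : nat) :
  {ae lambda, forall x : R, - n%:R < x < n%:R -> derivable h x (1 : R)}.
Proof.
(* Restricting to a bounded interval makes the Stieltjes measure finite, hence its density
   integrable. *)
pose D : set (measurableTypeR R) := `]- n%:R, n%:R]%classic.
have mD : measurable D by exact: measurable_itv.
have Dfin : (nu D < +oo)%E.
  by rewrite /D nu_itv ?ltry// (le_trans _ (ler0n _ _))// oppr_le0.
pose rho : {finite_measure set (measurableTypeR R) -> \bar R} := mfrestr mD Dfin.
have rho_dom : rho `<< lambda.
  move=> A A0 B mB BA; apply/eqP; rewrite eq_le measure_ge0 andbT.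
  apply: (@le_trans _ _ (nu B)).
    by apply: le_outer_measure; exact: subIsetl.
  by apply: le_trans (nu_le _) _; rewrite (A0 B mB BA) mule0.
have [f [f0 ffin intf rhoE]] := radon_nikodym_sigma_finite rho_dom.
pose phi := fine \o f.
have phiE : EFin \o phi = f by apply/funext => x; rewrite /= fineK.
have intphi : lambda.-integrable setT (EFin \o phi) by rewrite phiE.
have := @FTC1 R phi (BRight (- n%:R)).
have /[swap] /[apply] : forall y,
    lambda.-integrable [set` Interval (BRight (- n%:R)) (BRight y)] (EFin \o phi).
  by move=> y; apply: integrableS intphi => //; exact: measurable_itv.
have /[swap] /[apply] := open_integrable_locally openT intphi.
apply: filterS; first exact: (ae_filter_ringOfSetsType lambda).
move=> x + /andP[nx xn] => /(_ nx)[+ _].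
set F := (fun _ => _) => dF.
have FE y : - n%:R <= y <= n%:R -> F y = G y - G (- n%:R).
  move=> /andP[ny yn]; rewrite /F /Rintegral (_ : (fun t => (phi t)%:E) = f) //.
  rewrite -rhoE; last exact: measurable_itv.
  suff -> : rho `]- n%:R, y]%classic = (G y - G (- n%:R))%:E by [].
  rewrite -nu_itv//; change (nu (`]- n%:R, y]%classic `&` D) = nu `]- n%:R, y]%classic).
  congr (nu _); apply/seteqP; split => t; first by case.
  by move=> ty; split => //; move: ty; rewrite /D /= !in_itv/= => /andP[-> /le_trans]; apply.
(* This is [h] near [x], recovered from the primitive of the density. *)
pose F' y := F y + G (- n%:R) - K * y.
have dF1 : derivable (F + cst (G (- n%:R))) x 1.
  by apply: (derivableD dF); exact: derivable_cst.
have dK : derivable (K *: (id : R -> R)) x 1 by apply: derivableZ; exact: derivable_id.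
have dF' : derivable F' x 1 := derivableB dF1 dK.
apply: (near_eq_derivable _ dF').
have : x \in `]- n%:R, n%:R[ by rewrite in_itv/= nx.
move=> /near_in_itvoo; apply: filterS => y; rewrite in_itv/= => /andP[ny yn].
by rewrite /F' FE ?ltW//; rewrite /G; ring.
Qed.

Lemma lipschitz_ae_derivable : {ae lambda, forall x : R, derivable h x (1 : R)}.
Proof.
have := ae_foralln ae_derivable_itv; apply: negligibleS => x /= xh H; apply: xh.
by apply: (H (Num.truncn `|x|).+1); rewrite -ltr_norml truncnS_gt.
Qed.

End lipschitz_derivable.

(** * Density points *)

Section density_points.
Context {R : realType} {d : nat}.
Local Notation mu := (@lebesgue_rV R d).

(** Normalised by [r ^ d], to which the measure of the ball is comparable. *)
Definition density_point (A : set 'rV[R]_d) (x : 'rV[R]_d) : Prop :=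
  forall e : R, 0 < e -> exists2 dlt : R, 0 < dlt &
    forall r, 0 < r -> r < dlt -> (mu (ball x r `\` A) <= (e * r ^+ d)%:E)%E.

Theorem lebesgue_density_rV (A : set 'rV[R]_d) : measurable A ->
  {ae mu, forall x, A x -> density_point A x}.
Proof.
move=> mA; have mC : measurable (~` A) by exact: measurableC.
have intE x r : (\int[mu]_(y in ball x r) (\1_(~` A) y)%:E = mu (ball x r `\` A))%E.
  by rewrite integral_indic ?setDE 1?setIC//; exact: measurable_rV_ball.
have m1 : measurable_fun setT (fun y => (\1_(~` A) y : R)%:E).
  by apply/measurable_EFinP; exact: measurable_indic.
have fin (N : nat) : (\int[mu]_(y in ball (0 : 'rV[R]_d)%R (N.+1%:R)%R) (\1_(~` A) y)%:E < +oo)%E.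
  rewrite intE; apply: (@le_lt_trans _ _ (mu (ball (0 : 'rV[R]_d)%R (N.+1%:R)%R))).
    by apply: le_outer_measure; exact: subDsetl.
  by apply: le_lt_trans (ltry _); apply: lebesgue_rV_ball_le; rewrite ler0n.
have zero x : A x -> (\1_(~` A) x : R)%:E = 0%E by move=> Ax; rewrite indicE memNset//=; exact.
have := lebesgue_differentiation_zero_set m1 (fun _ => ler0n _ _) mA fin zero.
apply: filterS => x Hx Ax e /(Hx Ax)[dlt dlt0 H]; exists dlt => // r r0 rdlt.
by rewrite -intE; exact: H.
Qed.

Lemma density_point_approx A x (eta : R) : density_point A x -> 0 < eta ->
  exists2 dlt : R, 0 < dlt & forall r w, 0 < r -> r < dlt -> `|w - x| <= r ->
    exists2 z, A z & `|w - z| < eta * r.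
Proof.
move=> Ax eta0.
(* If [A] missed the ball of radius [eta * r] around [w], the ball of radius [(1 + eta) * r] around
   [x] would miss [A] on a set of measure at least [(eta * r) ^ d]; this threshold allows only half
   of that. *)
have e0 : 0 < (eta / (1 + eta)) ^+ d / 2 by rewrite divr_gt0// exprn_gt0// divr_gt0// addr_gt0.
have [dlt dlt0 H] := Ax _ e0; have eta1 : 0 < 1 + eta by rewrite addr_gt0.
exists (dlt / (1 + eta)); first by rewrite divr_gt0.
move=> r w r0; rewrite ltr_pdivlMr// => rdlt wx; apply: contrapT => nz.
have sub : ball w (eta * r) `<=` ball x (r * (1 + eta)) `\` A.
  move=> z wz; split; last first.
    by move=> Az; apply: nz; exists z => //; move: wz; rewrite ball_rVE.
  by apply: ball_subset wz; rewrite distrC; lra.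
have := H _ (mulr_gt0 r0 eta1) rdlt; apply/negP; rewrite -ltNge.
apply: (@lt_le_trans _ _ ((eta * r) ^+ d)%:E); last first.
  apply: (le_trans (lebesgue_rV_ball_ge w (mulr_gt0 eta0 r0))).
  exact: le_outer_measure.
have -> : (eta / (1 + eta)) ^+ d / 2 * (r * (1 + eta)) ^+ d = (eta * r) ^+ d / 2.
  by rewrite mulrAC -exprMn; congr (_ ^+ d / 2); field; rewrite gt_eqF.
by rewrite lte_fin ltr_pdivrMr// ltr_pMr ?ltr1n// exprn_gt0// mulr_gt0.
Qed.

End density_points.

Section rademacher.
Context {R : realType} {d : nat} (K : R) (F : 'rV[R]_d -> R).
Hypothesis K0 : 0 < K.
Hypothesis FK : forall x y, `|F x - F y| <= K * `|x - y|.
Local Notation mu := (@lebesgue_rV R d).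
Local Notation basis i := (delta_mx 0 i : 'rV[R]_d).

Lemma lipschitz_rV_continuous : continuous F.
Proof.
move=> x; have nx : Filter (nbhs x) := nbhs_filter x.
apply/cvgrPdist_le => e e0; have eK : 0 < e / K by rewrite divr_gt0.
have : nbhs x (ball x (e / K)) by exact: nbhsx_ballx.
apply: filterS => y; rewrite ball_rVE /= ltr_pdivlMr// mulrC => /ltW.
exact: le_trans.
Qed.

(** Rational slopes and scales [1/(n+1)] keep the family countable, and the uniform scale makes each
    set an intersection of conditions closed in [x]. *)
Definition partial_approx (e : R) (i : 'I_d) (q : rat) (n : nat) : set 'rV[R]_d :=
  [set x | forall s : R, `|s| < n.+1%:R^-1 ->
    `|F (x + s *: basis i) - F x - ratr q * s| <= e * `|s|].

Lemma closed_partial_approx e i q n : closed (partial_approx e i q n).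
Proof.
pose A s := [set x | `|F (x + s *: basis i) - F x - ratr q * s| <= e * `|s|].
rewrite (_ : partial_approx _ _ _ _ = \bigcap_(s in [set s : R | `|s| < n.+1%:R^-1]) A s) //.
apply: closed_bigI => s _.
pose G x := F (x + s *: basis i) - F x - ratr q * s.
rewrite (_ : A s = G @^-1` `[- (e * `|s|), e * `|s|]%classic); last first.
  by apply/seteqP; split => x; rewrite /A /G /= in_itv/= ler_norml.
apply: preimage_closed; last exact: interval_closed.
move=> x _; have nx : Filter (nbhs x) := nbhs_filter x.
apply: cvgB; last exact: cvg_cst.
apply: cvgB; last exact: lipschitz_rV_continuous.
apply: (cvg_comp (fun x => x + s *: basis i) F); last exact: lipschitz_rV_continuous.
by apply: cvgD; [exact: cvg_id|exact: cvg_cst].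
Qed.

Lemma derivable_rat_approx (phi : R -> R) (t e : R) : 0 < e -> derivable phi t 1 ->
  exists q (n : nat), forall s : R, `|s| < n.+1%:R^-1 ->
    `|phi (t + s) - phi t - ratr q * s| <= e * `|s|.
Proof.
move=> e0 /cvg_ex[l /= /cvgrPdist_lt/(_ _ (divr_gt0 e0 (@ltr0Sn R 1)))].
rewrite /dnbhs /within => /nbhs_ballP[dlt /= dlt0 H].
have [|q] := @rat_in_itvoo R (l - e / 2) (l + e / 2); first lra.
rewrite in_itv/= => /andP[lq ql].
have [n ndlt] := ex_natSinv_lt dlt0; exists q, n => s sn.
have [->|s0] := eqVneq s 0; first by rewrite addr0 subrr mulr0 subr0 normr0 mulr0.
have := H s; rewrite /ball /= sub0r normrN => /(_ (lt_trans sn ndlt) s0).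
rewrite scaler1 (addrC s) => Hs.
have s1 : 0 < `|s| by rewrite normr_gt0.
rewrite -ler_pdivrMr// -normfV -normrM.
have -> : (phi (t + s) - phi t - ratr q * s) / s =
    - (l - s^-1 *: (phi (t + s) - phi t)) + (l - ratr q).
  by rewrite /GRing.scale /=; field.
rewrite (le_trans (ler_normD _ _))// normrN.
have : `|l - ratr q| <= e / 2 by rewrite ler_norml; apply/andP; split; lra.
move: Hs; lra.
Qed.

(** Along each line parallel to the axis [i], the exceptional set lies where a Lipschitz function of
    one variable is not derivable; being Borel, it is null by its slices. *)
Lemma ae_partial_approx e i : 0 < e ->
  {ae mu, forall x, exists q n, partial_approx e i q n x}.
Proof.
move=> e0; pose N := ~` (\bigcup_(qn : rat * nat) partial_approx e i qn.1 qn.2).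
have mN : measurable (@row_of_tuple R d @^-1` N).
  rewrite /N -preimage_setC preimage_bigcup; apply: measurableC.
  apply: countable_bigcupT_measurable => // qn.
  rewrite -[partial_approx _ _ _ _]setCK -preimage_setC; apply: measurableC.
  by apply: measurable_tuple_open; apply: closed_openC; exact: closed_partial_approx.
have [mN' _] := lebesgue_rV_tuple mN.
suff N0 : mu N = 0%E.
  exists N; split => // x /= nx [[q n] _ /= qnx]; apply: nx; by exists q, n.
apply: (null_slices_lebesgue_rV mN (i := i)) => x.
pose phi s := F (x + s *: basis i).
have phiK s t : `|phi s - phi t| <= K * `|s - t|.
  apply: (le_trans (FK _ _)); rewrite ler_pM2l// opprD addrACA subrr add0r -scalerBl.
  rewrite normrZ; apply: ler_piMr => //; apply/rV_norm_leP => // j.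
  by rewrite mxE; case: (_ && _); rewrite ?normr1 ?normr0.
have [A [mA A0 subA]] := lipschitz_ae_derivable K0 phiK.
apply/eqP; rewrite eq_le measure_ge0 andbT -A0; apply: le_outer_measure => s Ns.
apply: subA => /= ds; apply: Ns; have [q [n H]] := derivable_rat_approx e0 ds.
by exists (q, n) => // h hn /=; have := H h hn; rewrite /phi scalerDl addrA.
Qed.

Definition grad_approx (e : R) (q : 'rV[rat]_d) (n : nat) : set 'rV[R]_d :=
  [set x | forall i, partial_approx e i (q 0 i) n x].

Lemma closed_grad_approx e q n : closed (grad_approx e q n).
Proof.
rewrite (_ : grad_approx e q n = \bigcap_(i : 'I_d) partial_approx e i (q 0 i) n).
  by apply: closed_bigI => i _; exact: closed_partial_approx.
by apply/seteqP; split => x H i //; exact: H.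
Qed.

Lemma ae_grad_approx e : 0 < e ->
  {ae mu, forall x, exists q n, grad_approx e q n x /\ density_point (grad_approx e q n) x}.
Proof.
move=> e0.
have : {ae mu, forall x, forall k (i : 'I_d), i = k :> nat -> exists q n, partial_approx e i q n x}.
  apply: ae_foralln => k; case: (ltnP k d) => kd; last first.
    by apply: aeW => x i ik; have := ltn_ord i; rewrite ik ltnNge kd.
  have := ae_partial_approx (Ordinal kd) e0; apply: filterS => x H i ik.
  by rewrite (_ : i = Ordinal kd)//; exact/val_inj.
have : {ae mu, forall x, forall (m : nat), let qn := odflt (0, 0%N) (unpickle m) in
    grad_approx e qn.1 qn.2 x -> density_point (grad_approx e qn.1 qn.2) x}.
  apply: ae_foralln => m; apply: lebesgue_density_rV.
  by apply: measurable_rV_closed; exact: closed_grad_approx.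
apply: filterS2 => x Hd Hx.
have /choice[qn qnP] i : exists qn : rat * nat, partial_approx e i qn.1 qn.2 x.
  by have [q [n H]] := Hx i i erefl; exists (q, n).
(* The largest of the indices gives the smallest of the scales, valid for all coordinates. *)
pose q := \row_i (qn i).1; pose n := \max_i (qn i).2.
have Sx : grad_approx e q n x.
  move=> i s sn; rewrite mxE; apply: qnP; apply: (lt_le_trans sn).
  by rewrite lef_pV2 ?posrE// ler_nat ltnS; exact: (leq_bigmax i).
exists q, n; split => //; have := Hd (pickle (q, n)); rewrite pickleK; exact.
Qed.

(* From a density point [x] of the set where the partial difference quotients are controlled,
   one reaches [x + y] coordinate by coordinate, each time replacing the current point by a
   nearby point of the set. *)
Lemma grad_approx_density e q n x : 0 < e -> grad_approx e q n x ->
  density_point (grad_approx e q n) x ->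
  exists2 dlt : R, 0 < dlt & forall y, `|y| < dlt ->
    `|F (x + y) - F x - dotv (map_mx ratr q) y| <= d%:R * (2 * K + 1) * e * `|y|.
Proof.
move=> e0 Sx /density_point_approx/(_ e0)[dlt dlt0 H].
have n0 : (0 : R) < n.+1%:R^-1 by rewrite invr_gt0.
exists (Num.min dlt n.+1%:R^-1); first by rewrite lt_min dlt0.
move=> y; rewrite lt_min => /andP[ydlt yn].
have [->|y0] := eqVneq y 0.
  rewrite addr0 subrr sub0r normrN normr0 mulr0 /dotv big1 ?normr0// => i _.
  by rewrite !mxE mulr0.
have ny0 : 0 < `|y| by rewrite normr_gt0.
(* [p j] keeps the first [j] coordinates of [y]. *)
pose p j : 'rV[R]_d := \row_i (if (i < j)%N then y 0 i else 0).
have pE j i : p j 0 i = (if (i < j)%N then y 0 i else 0) by rewrite mxE.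
(* Each coordinate costs [K * e] twice, to move to a nearby point [z] of the set and back, and [e]
   for the partial increment at [z], all times the norm of [y]. *)
suff walk j : (j <= d)%N ->
    `|F (x + p j) - F x - \sum_(i < d | (i < j)%N) ratr (q 0 i) * y 0 i| <=
    j%:R * (2 * K + 1) * e * `|y|.
  have := walk d (leqnn d); rewrite (_ : p d = y); last first.
    by apply/rowP => i; rewrite mxE ltn_ord.
  rewrite /dotv (_ : \sum_(i < d | _) _ = \sum_i map_mx ratr q 0 i * y 0 i)//.
  by apply: eq_big => i; rewrite ?ltn_ord// => _; rewrite mxE.
elim: j => [_|j ih jd].
  rewrite big_pred0//.
  rewrite (_ : p 0%N = 0); last by apply/rowP => i; rewrite !mxE.
  by rewrite addr0 subrr subr0 normr0 !mul0r.
pose i := Ordinal jd; have {ih} := ih (ltnW jd).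
have -> : \sum_(k < d | (k < j.+1)%N) ratr (q 0 k) * y 0 k =
    ratr (q 0 i) * y 0 i + \sum_(k < d | (k < j)%N) ratr (q 0 k) * y 0 k.
  rewrite (bigD1 i)//=; congr (_ + _); apply: eq_bigl => k.
  by rewrite ltnS andbC -(inj_eq val_inj) /= ltn_neqAle.
have pS : p j.+1 = p j + y 0 i *: basis i.
  apply/rowP => k; rewrite !mxE eqxx /= -(inj_eq val_inj) /= ltnS leq_eqVlt.
  have [kj|kj] := eqVneq (k : nat) j; last by rewrite mulr0 addr0.
  rewrite kj ltnn mulr1 add0r; congr (y 0 _); exact/val_inj.
have pjy : `|x + p j - x| <= `|y|.
  rewrite addrC addKr; apply/rV_norm_leP => // k; rewrite pE.
  by case: ifP => _; rewrite ?normr0// norm_coord_le.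
have [z Sz zp] := H _ (x + p j) ny0 ydlt pjy.
have yi : `|y 0 i| <= `|y| by exact: norm_coord_le.
have h1 := Sz i (y 0 i) (le_lt_trans yi yn).
have h2 := FK (x + p j.+1) (z + y 0 i *: basis i).
have h3 := FK (x + p j) z.
have zp' : `|x + p j.+1 - (z + y 0 i *: basis i)| = `|x + p j - z|.
  by rewrite pS addrA opprD addrACA subrr addr0.
rewrite zp' in h2.
have h4 : K * `|x + p j - z| <= K * (e * `|y|) by rewrite ler_pM2l// ltW.
have h5 : e * `|y 0 i| <= e * `|y| by rewrite ler_pM2l.
rewrite -natr1; set a := F (x + p j.+1) in h2 *; set b := F (z + _) in h1 h2.
set c := F (x + p j) in h3 *; set S := \sum_(k < d | _) _.
move=> h6.
have -> : a - F x - (ratr (q 0 i) * y 0 i + S) =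
    (a - b) + (b - F z - ratr (q 0 i) * y 0 i) + (F z - c) + (c - F x - S) by ring.
rewrite distrC in h3.
apply: (le_trans (ler_normD _ _)); apply: (le_trans (lerD (ler_normD _ _) (lexx _))).
apply: (le_trans (lerD (lerD (ler_normD _ _) (lexx _)) (lexx _))).
have h1' := le_trans h1 h5; have h2' := le_trans h2 h4; have h3' := le_trans h3 h4.
apply: (le_trans (lerD (lerD (lerD h2' h1') h3') h6)); lra.
Qed.

End rademacher.

Section differentiability.
Context {R : realType} {d : nat}.
Local Notation mu := (@lebesgue_rV R d).

Definition diff_at (F : 'rV[R]_d -> R) (x v : 'rV[R]_d) : Prop :=
  forall e : R, 0 < e -> exists2 dlt : R, 0 < dlt & forall y, `|y| < dlt ->
    `|F (x + y) - F x - dotv v y| <= e * `|y|.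

Lemma dotv_le (v y : 'rV[R]_d) (c : R) : (forall i, `|v 0 i| <= c) ->
  `|dotv v y| <= d%:R * c * `|y|.
Proof.
move=> vc; apply: (le_trans (ler_norm_sum _ _ _)).
have -> : d%:R * c * `|y| = \sum_(i < d) c * `|y| by rewrite sumr_const card_ord -mulrA mulr_natl.
apply: ler_sum => i _.
by rewrite normrM ler_pM// norm_coord_le.
Qed.

Lemma dotvBl (u v y : 'rV[R]_d) : dotv (u - v) y = dotv u y - dotv v y.
Proof. by rewrite /dotv -sumrB; apply: eq_bigr => i _; rewrite !mxE mulrBl. Qed.

Lemma dotv_delta (v : 'rV[R]_d) (s : R) i : dotv v (s *: delta_mx 0 i) = v 0 i * s.
Proof.
rewrite /dotv (bigD1 i)//= big1 ?addr0 => [|j ji]; rewrite !mxE ?eqxx ?mulr1//=.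
by rewrite (negbTE ji) !mulr0.
Qed.

(** The approximate gradients of precision [1/(m+1)] form a Cauchy sequence in each coordinate: any
    two are compared on a small multiple of a basis vector, valid for both. *)
Lemma almost_diff_at (F : 'rV[R]_d -> R) x :
  (forall e : R, 0 < e -> exists v, exists2 dlt : R, 0 < dlt & forall y, `|y| < dlt ->
    `|F (x + y) - F x - dotv v y| <= e * `|y|) -> exists v, diff_at F x v.
Proof.
move=> H; have m0 (m : nat) : 0 < m.+1%:R^-1 :> R by rewrite invr_gt0.
have /choice[q /= qP] m := H _ (m0 m).
have qq i m l : `|q m 0 i - q l 0 i| <= m.+1%:R^-1 + l.+1%:R^-1.
  have [dm dm0 Hm] := qP m; have [dl dl0 Hl] := qP l.
  pose s := Num.min dm dl / 2.
  have s0 : 0 < s by rewrite divr_gt0// lt_min dm0.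
  have sdl : s < Num.min dm dl by rewrite /s ltr_pdivrMr// ltr_pMr ?ltr1n// lt_min dm0.
  move: sdl; rewrite lt_min => /andP[sdm sdl].
  pose y : 'rV[R]_d := s *: delta_mx 0 i.
  have ys : `|y| <= s.
    apply/rV_norm_leP => [|j]; first exact: ltW.
    rewrite !mxE eqxx /=; case: (_ == _); rewrite ?mulr1 ?mulr0 ?normr0 ?gtr0_norm//; exact: ltW.
  have := Hm y (le_lt_trans ys sdm); have := Hl y (le_lt_trans ys sdl).
  rewrite !dotv_delta; set a := F (x + y) - F x => hl hm.
  rewrite -(ler_pM2r s0) -[X in _ * X](gtr0_norm s0) -normrM.
  have -> : (q m 0 i - q l 0 i) * s = (a - q l 0 i * s) - (a - q m 0 i * s) by ring.
  rewrite (le_trans (ler_normB _ _))// mulrDl addrC lerD//.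
    by apply: (le_trans hm); rewrite ler_pM2l.
  by apply: (le_trans hl); rewrite ler_pM2l.
(* The limit is obtained as a supremum of lower estimates; by [qq] each upper estimate bounds them
   all, so the limit is within [1/(m+1)] of [q m]. *)
pose E i := [set q m 0 i - m.+1%:R^-1 | m in [set: nat]].
have Eub i l : ubound (E i) (q l 0 i + l.+1%:R^-1).
  by move=> _ [m _ <-]; have := qq i m l; rewrite ler_norml => /andP[_]; set a := _^-1; set b := _^-1; lra.
pose v : 'rV[R]_d := \row_i sup (E i).
have qv m i : `|(q m - v) 0 i| <= m.+1%:R^-1.
  have E0 : E i !=set0 by exists (q 0%N 0 i - 1%:R^-1); exists 0%N.
  have h1 : sup (E i) <= q m 0 i + m.+1%:R^-1 by apply: ge_sup.
  have h2 : q m 0 i - m.+1%:R^-1 <= sup (E i).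
    apply: ub_le_sup; last by exists m.
    by exists (q 0%N 0 i + 1%:R^-1); exact: Eub.
  rewrite !mxE ler_norml; move: h1 h2; set a := _^-1 => h1 h2; apply/andP; split; lra.
(* One share of the error comes from [q m], and one for each of the [d] coordinates from replacing
   [q m] by [v]. *)
exists v => e e0; have e1 : 0 < e / (d%:R + 1) by rewrite divr_gt0// ltr_pwDr.
have [m me] := ex_natSinv_lt e1; have [dlt dlt0 Hm] := qP m.
exists dlt => // y ydlt.
have -> : F (x + y) - F x - dotv v y = (F (x + y) - F x - dotv (q m) y) + dotv (q m - v) y.
  by rewrite dotvBl; ring.
apply: (le_trans (ler_normD _ _)).
apply: (le_trans (lerD (Hm y ydlt) (dotv_le y (qv m)))).
rewrite -mulrDl ler_wpM2r//; move: me; rewrite ltr_pdivlMr ?ltr_pwDr//.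
by set a := _^-1; lra.
Qed.

Theorem rademacher (K : R) (F : 'rV[R]_d -> R) : 0 < K ->
  (forall x y, `|F x - F y| <= K * `|x - y|) -> {ae mu, forall x, exists v, diff_at F x v}.
Proof.
move=> K0 FK.
have m0 (m : nat) : 0 < m.+1%:R^-1 :> R by rewrite invr_gt0.
have : {ae mu, forall x, forall m : nat, exists q n, grad_approx F m.+1%:R^-1 q n x /\
    density_point (grad_approx F m.+1%:R^-1 q n) x}.
  by apply: ae_foralln => m; exact: ae_grad_approx K0 FK _ (m0 m).
apply: filterS => x H; apply: almost_diff_at => e e0.
have c0 : 0 < (d%:R + 1) * (2 * K + 1) by rewrite mulr_gt0 ?ltr_pwDr ?mulr_ge0// ltW.
have [m me] := ex_natSinv_lt (divr_gt0 e0 c0).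
have [q [n [Sx Dx]]] := H m.
have [dlt dlt0 Hy] := grad_approx_density K0 FK (m0 m) Sx Dx.
exists (map_mx ratr q), dlt => // y /Hy /le_trans; apply; apply: ler_wpM2r => //.
move: me; rewrite ltr_pdivlMr// mulrC => /ltW; apply: le_trans.
by rewrite ler_pM2r// ler_wpM2r// ?lerDl// addr_ge0// mulr_ge0// ltW.
Qed.

End differentiability.

(** * The Euclidean norm and Lipschitz extensions *)

Section euclidean_norm.
Context {R : realType} {d : nat}.
Implicit Types (u v w x y : 'rV[R]_d) (s : R).

Lemma dotvC u v : dotv u v = dotv v u.
Proof. by apply: eq_bigr => i _; rewrite mulrC. Qed.

Lemma dotvDr u v w : dotv u (v + w) = dotv u v + dotv u w.
Proof. by rewrite -big_split; apply: eq_bigr => i _; rewrite mxE mulrDr. Qed.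

Lemma dotvZr s u v : dotv u (s *: v) = s * dotv u v.
Proof. by rewrite mulr_sumr; apply: eq_bigr => i _; rewrite mxE mulrCA. Qed.

Lemma dotvDl u v w : dotv (u + v) w = dotv u w + dotv v w.
Proof. by rewrite ![dotv _ w]dotvC dotvDr. Qed.

Lemma dotvZl s u v : dotv (s *: u) v = s * dotv u v.
Proof. by rewrite ![dotv _ v]dotvC dotvZr. Qed.

Lemma dotv_linear u : linear (dotv u : 'rV[R]_d -> R^o).
Proof. by move=> s v w; rewrite dotvDr dotvZr. Qed.

Lemma dotvv_ge0 u : 0 <= dotv u u.
Proof. by apply: sumr_ge0 => i _; rewrite -expr2 sqr_ge0. Qed.

Lemma enorm_ge0 u : 0 <= enorm u. Proof. exact: sqrtr_ge0. Qed.

Lemma sqr_enorm u : enorm u ^+ 2 = dotv u u.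
Proof. by rewrite sqr_sqrtr// dotvv_ge0. Qed.

Lemma norm_le_enorm u : `|u| <= enorm u.
Proof.
apply/rV_norm_leP => [|i]; first exact: enorm_ge0.
rewrite -sqrtr_sqr ler_sqrt ?dotvv_ge0// /dotv (bigD1 i)//= expr2 lerDl.
by apply: sumr_ge0 => j _; rewrite -expr2 sqr_ge0.
Qed.

Lemma enorm_le_norm u : enorm u <= d%:R * `|u|.
Proof.
have [d0|d0] := posnP d.
  rewrite /enorm /dotv big1 ?sqrtr0 ?mulr_ge0// => i _.
  by have := ltn_ord i; rewrite [X in (_ < X)%N]d0.
rewrite -(@ger0_norm _ (d%:R * `|u|)) ?mulr_ge0// -sqrtr_sqr ler_sqrt ?sqr_ge0//.
apply: (@le_trans _ _ (d%:R * `|u| ^+ 2)).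
  have -> : d%:R * `|u| ^+ 2 = \sum_(i < d) `|u| ^+ 2 by rewrite sumr_const card_ord mulr_natl.
  apply: ler_sum => i _; rewrite -expr2 -(real_normK (num_real (u 0 i))) lerXn2r ?nnegrE//.
  exact: norm_coord_le.
by rewrite exprMn ler_wpM2r ?sqr_ge0// expr2 ler_peMr// ler1n.
Qed.

Lemma enormZ s u : enorm (s *: u) = `|s| * enorm u.
Proof.
by rewrite /enorm dotvZl dotvZr mulrA -expr2 sqrtrM ?sqr_ge0// sqrtr_sqr.
Qed.

Lemma enormN u : enorm (- u) = enorm u.
Proof. by rewrite -scaleN1r enormZ normrN1 mul1r. Qed.

Lemma enormC u v : enorm (u - v) = enorm (v - u).
Proof. by rewrite -enormN opprB. Qed.

Lemma enorm0 : enorm (0 : 'rV[R]_d) = 0.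
Proof. by rewrite -(scale0r 0) enormZ normr0 mul0r. Qed.

Lemma enorm_gt0 u : (0 < enorm u) = (u != 0).
Proof.
have [->|u0] := eqVneq u 0; first by rewrite enorm0 ltxx.
by apply: lt_le_trans (norm_le_enorm u); rewrite normr_gt0.
Qed.

Lemma cauchy_schwarz u v : `|dotv u v| <= enorm u * enorm v.
Proof.
have [->|v0] := eqVneq v 0.
  by rewrite enorm0 mulr0 -(scale0r 0) dotvZr mul0r normr0.
have nv0 : 0 < dotv v v by rewrite -sqr_enorm exprn_gt0// enorm_gt0.
rewrite -sqrtr_sqr -sqrtrM ?dotvv_ge0// ler_sqrt ?mulr_ge0 ?dotvv_ge0//.
have := dotvv_ge0 (dotv v v *: u - dotv u v *: v).
have -> : dotv (dotv v v *: u - dotv u v *: v) (dotv v v *: u - dotv u v *: v) =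
    dotv v v * (dotv u u * dotv v v - dotv u v ^+ 2).
  rewrite -scaleNr !(dotvDl, dotvDr, dotvZl, dotvZr) (dotvC v u); ring.
by rewrite pmulr_rge0// subr_ge0.
Qed.

Lemma enormD u v : enorm (u + v) <= enorm u + enorm v.
Proof.
have uv0 : 0 <= enorm u + enorm v by rewrite addr_ge0 ?enorm_ge0.
rewrite -(ger0_norm uv0) -sqrtr_sqr ler_sqrt ?sqr_ge0//.
rewrite !(dotvDl, dotvDr) (dotvC v u) sqrrD !sqr_enorm.
have := le_trans (ler_norm _) (cauchy_schwarz u v); lra.
Qed.

Lemma enorm_lipschitz x y : `|enorm x - enorm y| <= enorm (x - y).
Proof.
have h1 := enormD (x - y) y; rewrite subrK in h1.
have h2 := enormD (y - x) x; rewrite subrK enormC in h2.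
by rewrite ler_norml; apply/andP; split; lra.
Qed.

Lemma continuous_enorm : continuous (@enorm R d).
Proof.
apply: (@lipschitz_rV_continuous _ _ (d%:R + 1)) => [|x y]; first by rewrite ltr_pwDr.
apply: (le_trans (enorm_lipschitz _ _)); apply: (le_trans (enorm_le_norm _)).
by rewrite ler_wpM2r// lerDl.
Qed.

Lemma continuous_dotv u : continuous (dotv u).
Proof.
apply: (@lipschitz_rV_continuous _ _ (enorm u * d%:R + 1)) => [|x y].
  by rewrite ltr_pwDr// mulr_ge0// enorm_ge0.
have -> : dotv u x - dotv u y = dotv u (x - y) by rewrite !(dotvC u) dotvBl.
apply: (le_trans (cauchy_schwarz _ _)).
apply: (le_trans (ler_wpM2l (enorm_ge0 u) (enorm_le_norm _))).
by rewrite mulrA ler_wpM2r// lerDl.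
Qed.

Lemma measurable_enorm : measurable_fun [set: 'rV[R]_d] (@enorm R d).
Proof. exact/continuous_rV_measurable/continuous_enorm. Qed.

Lemma measurable_dotv u : measurable_fun [set: 'rV[R]_d] (dotv u).
Proof. exact/continuous_rV_measurable/continuous_dotv. Qed.

Lemma eball_ball (r : R) : eball r `<=` ball (0 : 'rV[R]_d) r.
Proof.
move=> y; rewrite ball_rVE /eball /= sub0r normrN; exact: le_lt_trans (norm_le_enorm _).
Qed.

Lemma measurable_eball (r : R) : measurable (eball r : set 'rV[R]_d).
Proof.
have := measurable_enorm measurableT (measurable_itv `]-oo, r[); rewrite setTI.
by congr measurable; apply/seteqP; split => y; rewrite /= in_itv.
Qed.

Lemma ball_eball (r : R) : (0 < d)%N -> ball (0 : 'rV[R]_d) (r / d%:R) `<=` eball r.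
Proof.
move=> d0 y; rewrite ball_rVE /eball /= sub0r normrN ltr_pdivlMr ?ltr0n// mulrC.
exact: le_lt_trans (enorm_le_norm _).
Qed.

(** McShane's formula, the infimum over [z] in [E] of [f z + K * enorm (x - z)]. The same constant
    for the Euclidean norm is kept, since it is what bounds the gradient. *)
Lemma mcshane_extension (f : 'rV[R]_d -> R) (E : set 'rV[R]_d) (K : R) : 0 <= K ->
  (forall x y, E x -> E y -> `|f x - f y| <= K * enorm (x - y)) ->
  exists F, (forall x, E x -> F x = f x) /\ forall x y, `|F x - F y| <= K * enorm (x - y).
Proof.
move=> K0 fK; have [[z0 Ez0]|nE] := pselect (E !=set0); last first.
  exists (cst 0); split => [x Ex|x y]; first by case: nE; exists x.
  by rewrite subrr normr0 mulr_ge0// enorm_ge0.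
pose V x := [set f z + K * enorm (x - z) | z in E].
have V0 x : V x !=set0 by exists (f z0 + K * enorm (x - z0)); exists z0.
have lbV x y z : E y -> E z -> f z - K * enorm (x - z) <= f y + K * enorm (x - y).
  move=> Ey Ez; have := fK _ _ Ez Ey; rewrite ler_norml => /andP[_].
  have := enormD (z - x) (x - y); rewrite addrA subrK (enormC z x) => h.
  have := ler_wpM2l K0 h; rewrite mulrDr; lra.
have hV x : has_inf (V x).
  split; first exact: V0.
  by exists (f z0 - K * enorm (x - z0)) => _ [y Ey <-]; exact: lbV.
exists (fun x => inf (V x)); split => [x Ex|].
  apply/le_anti/andP; split.
    by apply: ge_inf; [case: (hV x)|exists x => //; rewrite subrr enorm0 mulr0 addr0].
  apply: lb_le_inf => // _ [z Ez <-].
  by have := lbV x z x Ez Ex; rewrite subrr enorm0 mulr0 subr0.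
have le x y : inf (V x) <= inf (V y) + K * enorm (x - y).
  rewrite -lerBlDr; apply: lb_le_inf => // _ [z Ez <-]; rewrite lerBlDr.
  apply: (@le_trans _ _ (f z + K * enorm (x - z))).
    by apply: ge_inf; [case: (hV x)|exists z].
  have := enormD (x - y) (y - z); rewrite addrA subrK => h.
  have := ler_wpM2l K0 h; rewrite mulrDr; lra.
move=> x y; have h1 := le x y; have h2 := le y x; rewrite enormC in h2.
by rewrite ler_norml; apply/andP; split; lra.
Qed.

End euclidean_norm.

(** * Uniqueness of weak differentials *)

Lemma measurable_EFin_funTS d (T : measurableType d) (R : realType) (D : set T) (u : T -> R) :
  measurable_fun setT u -> measurable_fun D (fun y => (u y)%:E).
Proof. by move=> mu; apply: measurable_funTS; exact/measurable_EFinP. Qed.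

Section integral_bounds.
Context d (T : measurableType d) (R : realType) (mu : {measure set T -> \bar R}).

Lemma ge0_integral_le_affine (D : set T) (phi h : T -> \bar R) (e C : R) :
  measurable D -> measurable_fun D phi -> measurable_fun D h ->
  (forall x, 0 <= phi x)%E -> (forall x, 0 <= h x)%E -> 0 <= e -> 0 <= C ->
  (forall x, D x -> phi x <= e%:E + C%:E * h x)%E ->
  (\int[mu]_(x in D) phi x <= e%:E * mu D + C%:E * \int[mu]_(x in D) h x)%E.
Proof.
move=> mD mphi mh phi0 h0 e0 C0 le.
have Ch0 x : (0 <= C%:E * h x)%E by rewrite mule_ge0// lee_fin.
have mCh : measurable_fun D (fun x => C%:E * h x)%E by exact: measurable_funeM.
rewrite -(integral_cst mu mD) -ge0_integralZl//.
rewrite -ge0_integralD//.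
apply: ge0_le_integral => //; exact: emeasurable_funD.
Qed.

Lemma ge0_integral_leD (D : set T) (phi a b : T -> \bar R) :
  measurable D -> measurable_fun D phi -> measurable_fun D a -> measurable_fun D b ->
  (forall x, 0 <= phi x)%E -> (forall x, 0 <= a x)%E -> (forall x, 0 <= b x)%E ->
  (forall x, D x -> phi x <= a x + b x)%E ->
  (\int[mu]_(x in D) phi x <= \int[mu]_(x in D) a x + \int[mu]_(x in D) b x)%E.
Proof.
move=> mD mphi ma mb phi0 a0 b0 le; rewrite -ge0_integralD//.
apply: ge0_le_integral => //; exact: emeasurable_funD.
Qed.

Lemma ge0_integral_ge_cst (D E : set T) (phi : T -> \bar R) (c : R) :
  measurable D -> measurable E -> measurable_fun D phi -> (forall x, 0 <= phi x)%E ->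
  0 <= c -> E `<=` D -> (forall x, E x -> c%:E <= phi x)%E ->
  (c%:E * mu E <= \int[mu]_(x in D) phi x)%E.
Proof.
move=> mD mE mphi phi0 c0 ED le; rewrite -(integral_cst mu mE).
apply: (@le_trans _ _ (\int[mu]_(x in E) phi x)%E); last exact: ge0_subset_integral.
by apply: ge0_le_integral => //; exact: measurable_funS mphi.
Qed.

End integral_bounds.

Lemma min1_triangle (R : realType) (a b : R) :
  Num.min `|b - a| 1 <= Num.min `|a| 1 + Num.min `|b| 1.
Proof.
have := ler_normB b a; have := normr_ge0 a; have := normr_ge0 b.
have [?|?] := leP `|b - a| 1; have [?|?] := leP `|a| 1; have [?|?] := leP `|b| 1; lra.
Qed.

Lemma cvg_at_right0_le (R : realType) (u : R -> \bar R) :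
  (forall r, 0 <= u r)%E ->
  (forall e : R, 0 < e -> exists2 dlt : R, 0 < dlt & forall r, 0 < r -> r < dlt -> (u r <= e%:E)%E) ->
  u r @[r --> 0^'+] --> 0%E.
Proof.
move=> u0 H.
have fin : \forall r \near 0^'+, u r \is a fin_num.
  have [dlt dlt0 Hd] := H 1 ltr01; near=> r.
  rewrite ge0_fin_numE//; apply: le_lt_trans (ltry 1); apply: Hd; near: r.
    exact: nbhs_right_gt.
  exact: nbhs_right_lt.
apply/fine_cvgP; split => //; apply/cvgrPdist_le => e e0.
have [dlt dlt0 Hd] := H e e0; near=> r; rewrite sub0r normrN /= ger0_norm ?fine_ge0//.
rewrite -lee_fin fineK; last by near: r.
by apply: Hd; near: r; [exact: nbhs_right_gt|exact: nbhs_right_lt].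
Unshelve. all: by end_near. Qed.

Lemma cvg_at_right0_lt (R : realType) (u : R -> \bar R) (e : R) :
  u r @[r --> 0^'+] --> 0%E -> 0 < e ->
  exists2 dlt : R, 0 < dlt & forall r, 0 < r -> r < dlt -> (u r <= e%:E)%E.
Proof.
move=> u0 e0; have : nbhs (0%E : \bar R) [set x | (x < e%:E)%E].
  by apply: open_nbhs_nbhs; split; [exact: open_ereal_lt_ereal|rewrite /= lte_fin].
move=> /u0 /nbhs_ballP[dlt /= dlt0 H]; exists dlt => // r r0 rdlt; apply/ltW/H => //.
by rewrite /ball /= sub0r normrN gtr0_norm.
Qed.

Section weak_differentials.
Context {R : realType} {d : nat} (f : 'rV[R]_d -> R).
Hypothesis d0 : (0 < d)%N.
Hypothesis mf : measurable_fun [set: 'rV[R]_d] f.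
Local Notation mu := (@lebesgue_rV R d).

Definition weak_quotient (x : 'rV[R]_d) (L : 'rV[R]_d -> R) (r : R) (y : 'rV[R]_d) : R :=
  Num.min `|(f (x + r *: y) - f x - L (r *: y)) / (r * enorm y)| 1.

Lemma weak_quotient_ge0 x L r y : 0 <= weak_quotient x L r y.
Proof. by rewrite le_min normr_ge0 ler01. Qed.

Lemma measurable_inv_enorm (r : R) : 0 < r ->
  measurable_fun [set: 'rV[R]_d] (fun y => (r * enorm y)^-1).
Proof.
move=> r0; rewrite (_ : (fun _ => _) = (fun y : 'rV[R]_d => (r * enorm y) `^ (-1))).
  apply: (measurableT_comp (measurable_powR _)).
  exact: measurable_funM (measurable_cst _) measurable_enorm.
by apply/funext => y; rewrite powR_inv1// mulr_ge0 ?enorm_ge0// ltW.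
Qed.

Lemma measurable_weak_quotient x v r : 0 < r ->
  measurable_fun [set: 'rV[R]_d] (weak_quotient x (dotv v) r).
Proof.
move=> r0; apply: measurable_minr; last exact: measurable_cst.
apply: measurableT_comp; first exact: normr_measurable.
apply: measurable_funM; last exact: measurable_inv_enorm.
have maff := measurable_rV_affine x r0.
apply: measurable_funB.
  exact: measurable_funB (measurableT_comp mf maff) (measurable_cst _).
rewrite (_ : (fun y => dotv v (r *: y)) = (fun y => r * dotv v y)).
  exact: measurable_funM (measurable_cst _) (measurable_dotv v).
by apply/funext => y; rewrite dotvZr.
Qed.

(** The function [phi] does not depend on [r], yet it is at most the sum of the two quotients at
    every scale, so its integral is [0]; if [w] were nonzero, [phi] would be bounded below on a
    small cube. *)
Lemma weak_differential_unique x u v :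
  is_weak_differential f x (dotv u) -> is_weak_differential f x (dotv v) -> u = v.
Proof.
move=> [_ /(_ 1 ltr01) cu] [_ /(_ 1 ltr01) cv]; apply/eqP; rewrite -subr_eq0; apply/negPn/negP.
set w := u - v => w0; have nw : 0 < enorm w by rewrite enorm_gt0.
pose phi (y : 'rV[R]_d) := Num.min (`|dotv w y| / enorm y) 1.
have phi0 y : 0 <= phi y by rewrite le_min divr_ge0 ?enorm_ge0//=.
have mphi : measurable_fun setT phi.
  apply: measurable_minr; last exact: measurable_cst.
  apply: measurable_funM.
    by apply: measurableT_comp; [exact: normr_measurable|exact: measurable_dotv].
  by have := measurable_inv_enorm (@ltr01 R); under eq_fun do rewrite mul1r.
have split r y : 0 < r ->
    ((phi y)%:E <= (weak_quotient x (dotv u) r y)%:E + (weak_quotient x (dotv v) r y)%:E)%E.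
  move=> r0; rewrite -EFinD lee_fin /phi /weak_quotient.
  set A := f _ - f x.
  have -> : `|dotv w y| / enorm y = `|(A - dotv v (r *: y)) / (r * enorm y) -
      (A - dotv u (r *: y)) / (r * enorm y)|.
    rewrite -mulrBl /w dotvBl !dotvZr.
    have -> : A - r * dotv v y - (A - r * dotv u y) = r * (dotv u y - dotv v y) by ring.
    by rewrite -mulf_div mulfV ?gt_eqF// mul1r normrM normfV (ger0_norm (enorm_ge0 _)).
  exact: min1_triangle.
have mball : measurable (eball 1 : set 'rV[R]_d) by exact: measurable_eball.
(* The cube of radius [rho] around [y0], which has norm [1 / 2] and the direction of [w], stays
   within Euclidean distance [1 / 4] of [y0]: inside the unit ball, with [dotv w y] at least
   [enorm w / 4]. *)
pose rho : R := (4 * d%:R)^-1.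
have dR0 : 0 < d%:R :> R by rewrite ltr0n.
have rho0 : 0 < rho by rewrite invr_gt0 mulr_gt0.
pose y0 := (2 * enorm w)^-1 *: w.
have near_y0 y : ball y0 rho y -> enorm (y - y0) < 4^-1.
  rewrite ball_rVE /= distrC => yy0; apply: (le_lt_trans (enorm_le_norm _)).
  by rewrite -ltr_pdivlMl// (lt_le_trans yy0)// /rho invfM mulrC.
have wy0 : dotv w y0 = enorm w / 2.
  by rewrite dotvZr -sqr_enorm invfM -mulrA expr2 mulKf ?gt_eqF// mulrC.
have ey0 : enorm y0 = 2^-1.
  by rewrite enormZ gtr0_norm ?invr_gt0 ?mulr_gt0// invfM -mulrA mulVf ?mulr1// gt_eqF.
have ballS : ball y0 rho `<=` eball 1.
  move=> y /near_y0 yy0; rewrite /eball /=.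
  by have := enormD (y - y0) y0; rewrite subrK ey0; lra.
pose c := Num.min (enorm w / 4) 1; have c0 : 0 < c by rewrite lt_min divr_gt0//=.
have phic y : ball y0 rho y -> (c%:E <= (phi y)%:E)%E.
  move=> yB; have yy0 := near_y0 _ yB; have y1 := ballS _ yB; rewrite /eball /= in y1.
  have h : enorm w / 4 <= `|dotv w y|.
    have := cauchy_schwarz w (y - y0); rewrite dotvC dotvBl !(dotvC _ w) wy0.
    have := ltW yy0; rewrite -(ler_pM2l nw) ler_norml; have := ler_norm (dotv w y).
    by move=> h1 h2 /andP[h3 _]; lra.
  have ey : 0 < enorm y.
    rewrite enorm_gt0; apply/eqP => y00; move: h; rewrite y00 -(scale0r 0) dotvZr mul0r normr0.
    by rewrite leNgt divr_gt0.
  rewrite lee_fin /c /phi le_min ge_min ler_pdivlMr// ge_min lexx orbT andbT.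
  by apply/orP; left; apply: le_trans h; rewrite ler_piMr ?ltW// divr_gt0.
have int_c : (c%:E * mu (ball y0 rho) <= \int[mu]_(y in eball 1) (phi y)%:E)%E.
  have mB : measurable (ball y0 rho) by exact: measurable_rV_ball.
  by apply: (ge0_integral_ge_cst mu mball mB (measurable_EFin_funTS mphi) _ (ltW c0) ballS phic) => y;
    rewrite lee_fin.
(* Two such thirds remain below the lower bound [c * rho ^+ d]. *)
have crho0 : 0 < c * rho ^+ d / 3 by rewrite divr_gt0// mulr_gt0// exprn_gt0.
have [d1 d10 H1] := cvg_at_right0_lt cu crho0.
have [d2 d20 H2] := cvg_at_right0_lt cv crho0.
pose r := Num.min d1 d2 / 2.
have r0 : 0 < r by rewrite divr_gt0// lt_min d10.
have : r < Num.min d1 d2 by rewrite /r ltr_pdivrMr// ltr_pMr ?ltr1n// lt_min d10.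
rewrite lt_min => /andP[rd1 rd2].
have := H1 r r0 rd1; have := H2 r r0 rd2 => h2 h1.
have : (\int[mu]_(y in eball 1) (phi y)%:E <= (c * rho ^+ d / 3)%:E + (c * rho ^+ d / 3)%:E)%E.
  have mwq w' := measurable_EFin_funTS (measurable_weak_quotient x w' r0).
  have wq0 w' y : (0 <= (weak_quotient x (dotv w') r y)%:E)%E.
    by rewrite lee_fin weak_quotient_ge0.
  have phi0' y : (0 <= (phi y)%:E)%E by rewrite lee_fin.
  apply: le_trans _ (leeD h1 h2).
  exact: (ge0_integral_leD mu mball (measurable_EFin_funTS mphi) (mwq _ u) (mwq _ v)
    phi0' (wq0 u) (wq0 v) (fun y _ => split r y r0)).
move=> /(le_trans int_c); apply/negP; rewrite -ltNge.
apply: (@lt_le_trans _ _ (c%:E * (rho ^+ d)%:E)%E); last first.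
  by apply: lee_pmul => //; [rewrite lee_fin ltW|rewrite lee_fin exprn_ge0// ltW|exact: lebesgue_rV_ball_ge].
have := mulr_gt0 c0 (exprn_gt0 d rho0); rewrite -EFinD -EFinM lte_fin; lra.
Qed.

Lemma weak_gradientE x v : is_weak_differential f x (dotv v) -> weak_gradient f x = v.
Proof.
move=> xv; rewrite /weak_gradient; case: xgetP => [u _ xu|/(_ v)] //.
exact: weak_differential_unique xu xv.
Qed.

End weak_differentials.

(** * Tame points of a function with a majorant *)

Section tame_points.
Context {R : realType} {d : nat} (p : R) (f : 'rV[R]_d -> R) (g : 'rV[R]_d -> \bar R).
Hypothesis d0 : (0 < d)%N.
Hypothesis p1 : 1 <= p.
Hypothesis mf : measurable_fun [set: 'rV[R]_d] f.
Hypothesis mg : measurable_fun [set: 'rV[R]_d] g.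
Hypothesis g0 : forall x, (0 <= g x)%E.
Hypothesis fg : forall x y, x <> y ->
  (`|f x - f y|%:E <= (enorm (x - y))%:E * (expeR (g x + g y) - 1))%E.
Local Notation mu := (@lebesgue_rV R d).

Definition sublevel (q : R) : set 'rV[R]_d := [set x | (g x <= q%:E)%E].

(* The summand [1] makes the points where the integral of the excess vanishes to order [d] density
   points of the sublevel; the summand [g `^ p] controls the logarithm outside of it. *)
Definition excess (q : R) : 'rV[R]_d -> \bar R := (fun x => 1 + g x `^ p)%E \_ (~` sublevel q).

Lemma measurable_sublevel q : measurable (sublevel q).
Proof.
by have := emeasurable_fun_infty_c measurableT mg q%:E; rewrite setTI.
Qed.

Lemma measurable_excess q : measurable_fun setT (excess q).
Proof.
apply/(measurable_restrictT _ _).1; first exact/measurableC/measurable_sublevel.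
apply: measurable_funTS; apply: emeasurable_funD; first exact: measurable_cst.
exact: (measurableT_comp (measurable_poweR p) mg).
Qed.

Lemma excess_ge0 q x : (0 <= excess q x)%E.
Proof. by apply: erestrict_ge0 => y _; rewrite adde_ge0// poweR_ge0. Qed.

Lemma excess_sublevel q x : sublevel q x -> excess q x = 0%E.
Proof. by move=> xq; rewrite /excess patchE memNset//=; exact. Qed.

Lemma excess_out q x : ~ sublevel q x -> excess q x = (1 + g x `^ p)%E.
Proof. by move=> xq; rewrite /excess patchE mem_set. Qed.

Definition vanishing_excess q x : Prop := forall e : R, 0 < e -> exists2 dlt : R, 0 < dlt &
  forall r, 0 < r -> r < dlt -> (\int[mu]_(y in ball x r) excess q y <= (e * r ^+ d)%:E)%E.

Lemma vanishing_excess_density q x e r : (\int[mu]_(y in ball x r) excess q y <= e%:E)%E ->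
  (mu (ball x r `\` sublevel q) <= e%:E)%E.
Proof.
apply: le_trans; rewrite -[leLHS]mul1e.
have mB : measurable (ball x r) by exact: measurable_rV_ball.
have mD : measurable (ball x r `\` sublevel q) by apply: measurableD; last exact: measurable_sublevel.
have mE := measurable_funTS (measurable_excess q) : measurable_fun (ball x r) (excess q).
apply: (ge0_integral_ge_cst mu mB mD mE (excess_ge0 q) ler01).
  exact: subDsetl.
by move=> y [_ yq]; rewrite excess_out// leeDl// poweR_ge0.
Qed.

Lemma sublevel_lipschitz q x y : sublevel q x -> sublevel q y ->
  `|f x - f y| <= (expR (2 * q) - 1) * enorm (x - y).
Proof.
move=> xq yq; have [->|/eqP xy] := eqVneq x y; first by rewrite !subrr normr0 enorm0 mulr0.
have := fg xy; move: xq yq (g0 x) (g0 y); rewrite /sublevel /=.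
case: (g x) (g y) => [a||] [b||]//=; rewrite !lee_fin => aq bq a0 b0.
move=> h; have {}h : `|f x - f y| <= enorm (x - y) * (expR (a + b) - 1) by rewrite -lee_fin.
by apply: (le_trans h); rewrite mulrC ler_wpM2r ?enorm_ge0// lerB// ler_expR; lra.
Qed.

Lemma sublevel_ge0 q x : sublevel q x -> 0 <= q.
Proof. by move=> xq; rewrite -lee_fin; exact: le_trans (g0 x) xq. Qed.

Definition extension q (F : 'rV[R]_d -> R) : Prop :=
  (forall z, sublevel q z -> F z = f z) /\
  forall y z, `|F y - F z| <= (expR (2 * q) - 1) * enorm (y - z).

Lemma ex_extension q : 0 <= q -> exists F, extension q F.
Proof.
move=> q0; apply: mcshane_extension; last exact: sublevel_lipschitz.
by rewrite subr_ge0 -expR0 ler_expR mulr_ge0.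
Qed.

Definition tame q x v : Prop :=
  [/\ sublevel q x, exists F, extension q F /\ diff_at F x v & vanishing_excess q x].

(** The increment is tested on [F] along [v] itself, because the segment may leave the sublevel,
    where [f] is not controlled. *)
Lemma tame_gradient_bound q x v : tame q x v -> enorm v <= expR (2 * q) - 1.
Proof.
move=> [xq [F [[_ FK] Fv]] _]; have q0 := sublevel_ge0 xq.
have K0 : 0 <= expR (2 * q) - 1 by rewrite subr_ge0 -expR0 ler_expR mulr_ge0.
have [->|v0] := eqVneq v 0; first by rewrite enorm0.
have nv : 0 < enorm v by rewrite enorm_gt0.
apply/ler_addgt0Pr => e e0; have [dlt dlt0 H] := Fv e e0.
pose t := dlt / (2 * enorm v); have t0 : 0 < t by rewrite divr_gt0// mulr_gt0.
have tv : enorm (t *: v) = t * enorm v by rewrite enormZ gtr0_norm.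
have tvd : `|t *: v| < dlt.
  apply: (le_lt_trans (norm_le_enorm _)); rewrite tv /t invfM mulrA divfK ?gt_eqF//; lra.
have := H _ tvd; have := FK (x + t *: v) x.
rewrite addrAC subrr add0r tv dotvZr -sqr_enorm.
have := norm_le_enorm (t *: v); rewrite tv => h1 h2 h3.
rewrite -(ler_pM2r (mulr_gt0 t0 nv)).
have := ler_wpM2l (ltW e0) h1; have := ler_norm (F (x + t *: v) - F x); move: h3.
set A := F _ - F x in h2 *; rewrite ler_norml => /andP[h3 _].
have -> : enorm v * (t * enorm v) = t * enorm v ^+ 2 by ring.
rewrite mulrDl; lra.
Qed.

(** On the sublevel [f] is [F], differentiable at [x]; outside of it the truncation bounds the
    quotient by [1], on a set that is small after rescaling. *)
Lemma tame_weak_differential q x v : tame q x v -> is_weak_differential f x (dotv v).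
Proof.
move=> [xq [F [[Ff FK] Fv]] vx]; split; first exact: dotv_linear.
move=> rho rho0; apply: cvg_at_right0_le => [r|e e0].
  by apply: integral_ge0 => y _; rewrite lee_fin le_min normr_ge0 ler01.
have rhod : 0 < rho ^+ d by rewrite exprn_gt0.
have rhod2 : 0 < (2 * rho) ^+ d by rewrite exprn_gt0// mulr_gt0.
(* The denominator [(2 * rho) ^+ d] bounds the measure of the domain; [rho ^+ d] is what remains of
   [(r * rho) ^+ d] after the rescaling by [r]. *)
have e10 : 0 < e / 2 / (2 * rho) ^+ d by rewrite !divr_gt0.
have e20 : 0 < e / 2 / rho ^+ d by rewrite !divr_gt0.
have [d1 d10 H1] := Fv _ e10; have [d2 d20 H2] := vx _ e20.
exists (Num.min d1 d2 / rho); first by rewrite divr_gt0// lt_min d10.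
move=> r r0; rewrite ltr_pdivlMr// lt_min => /andP[rd1 rd2].
pose phi y : 'rV[R]_d := x + r *: y.
have mphi : measurable (phi @^-1` (~` sublevel q)).
  by apply: measurable_rV_affine_preimage => //; exact/measurableC/measurable_sublevel.
have le y : eball rho y -> ((weak_quotient f x (dotv v) r y)%:E <=
    (e / 2 / (2 * rho) ^+ d)%:E + 1%:E * (\1_(phi @^-1` (~` sublevel q)) y)%:E)%E.
  move=> yrho; rewrite mul1e -EFinD lee_fin.
  have [yq|yq] := pselect (sublevel q (phi y)); last first.
    rewrite indicE mem_set//= /weak_quotient ge_min; apply/orP; right.
    by rewrite lerDr ltW.
  rewrite indicE memNset ?addr0; last by move=> /=; exact.
  rewrite /weak_quotient ge_min -(Ff _ yq) -(Ff _ xq); apply/orP; left.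
  have ryd : `|r *: y| < d1.
    rewrite normrZ gtr0_norm// (lt_trans _ rd1)// ltr_pM2l//.
    exact: le_lt_trans (norm_le_enorm y) yrho.
  have [->|y0] := eqVneq y 0; first by rewrite enorm0 mulr0 invr0 mulr0 normr0 ltW.
  have ry0 : 0 < r * enorm y by rewrite mulr_gt0// enorm_gt0.
  rewrite normrM normfV (gtr0_norm ry0) ler_pdivrMr//.
  apply: (le_trans (H1 _ ryd)); rewrite ler_pM2l// normrZ gtr0_norm// ler_pM2l//.
  exact: norm_le_enorm.
have mB : measurable (eball rho : set 'rV[R]_d) := measurable_eball rho.
have ind0 y : (0 <= (\1_(phi @^-1` (~` sublevel q)) y : R)%:E)%E by rewrite lee_fin.
have wq0 y : (0 <= (weak_quotient f x (dotv v) r y)%:E)%E by rewrite lee_fin weak_quotient_ge0.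
have mwq := measurable_EFin_funTS (measurable_weak_quotient mf x v r0) : measurable_fun (eball rho) _.
have mind := measurable_EFin_funTS (measurable_indic mphi) :
  measurable_fun (eball rho) (fun y => (\1_(phi @^-1` (~` sublevel q)) y : R)%:E).
apply: (le_trans (ge0_integral_le_affine mu mB mwq mind wq0 ind0 (ltW e10) ler01 le)).
have -> : e%:E = ((e / 2)%:E + (e / 2)%:E)%E by rewrite -EFinD -splitr.
rewrite mul1e integral_indic//; apply: leeD.
  apply: (@le_trans _ _ ((e / 2 / (2 * rho) ^+ d)%:E * ((2 * rho) ^+ d)%:E)%E).
    apply: lee_pmul; [by rewrite lee_fin ltW|exact: measure_ge0|exact: lexx|].
    apply: le_trans (lebesgue_rV_ball_le 0 (ltW rho0)).
    by apply: le_outer_measure; exact: eball_ball.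
  by rewrite -EFinM divfK// gt_eqF.
have sub : phi @^-1` (~` sublevel q) `&` eball rho `<=` phi @^-1` (ball x (r * rho) `\` sublevel q).
  move=> y [yq yr]; split => //; rewrite ball_rVE /phi /= opprD addrA subrr add0r normrN normrZ.
  by rewrite gtr0_norm// ltr_pM2l//; exact: le_lt_trans (norm_le_enorm y) yr.
apply: (@le_trans _ _ (mu (phi @^-1` (ball x (r * rho) `\` sublevel q)))).
  exact: le_outer_measure.
have := vanishing_excess_density (H2 _ (mulr_gt0 r0 rho0) rd2).
have -> : e / 2 / rho ^+ d * (r * rho) ^+ d = r ^+ d * (e / 2).
  by rewrite exprMn; field; rewrite gt_eqF.
rewrite (lebesgue_rV_affine x _ r0) EFinM.
have rd0 : 0 < r ^+ d by rewrite exprn_gt0.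
by rewrite -lee_pdivlMl// -!EFinM mulKf// gt_eqF.
Qed.

Definition log_quotient x v (y : 'rV[R]_d) : R :=
  ln (1 + `|f (x + y) - f x - dotv v y| / enorm y) `^ p.

(** On the sublevel the quotient is at most [e], and [e ^ p <= e]. Outside, with [b = g (x + y)]
    finite, one plus the quotient is at most [exp (q + b) * (1 + enorm v)], so the logarithm is at
    most [M + b]; the constant comes from [(M + b) ^ p <= 2 ^ p * (M ^ p + b ^ p) <= 2 ^ p * (1 + M
    ^ p) * (1 + b ^ p)]. *)
Lemma log_quotient_le q x v (e : R) : tame q x v -> 0 < e -> e <= 1 ->
  exists2 dlt : R, 0 < dlt & forall y, `|y| < dlt -> ((log_quotient x v y)%:E <=
    e%:E + (2 `^ p * (1 + (q + ln (1 + enorm v)) `^ p))%:E * excess q (x + y)%R)%E.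
Proof.
move=> [xq [F [[Ff FK] Fv]] vx] e0 e1; have q0 := sublevel_ge0 xq.
have p0 : 0 <= p by exact: le_trans p1.
have lnv0 : 0 <= ln (1 + enorm v) by rewrite ln_ge0// lerDl enorm_ge0.
set M := q + _; have M0 : 0 <= M by rewrite addr_ge0.
have C0 : 0 <= 2 `^ p * (1 + M `^ p) by rewrite mulr_ge0 ?powR_ge0// addr_ge0 ?powR_ge0.
have [dlt dlt0 H] := Fv e e0; exists dlt => // y yd.
have quot0 : 0 <= `|f (x + y) - f x - dotv v y| / enorm y by rewrite divr_ge0 ?enorm_ge0.
have lnq0 := ln_ge0 (_ : 1 <= 1 + `|f (x + y) - f x - dotv v y| / enorm y).
have [xyq|xyq] := pselect (sublevel q (x + y)).
  rewrite excess_sublevel// mule0 adde0 lee_fin /log_quotient.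
  have quote : `|f (x + y) - f x - dotv v y| / enorm y <= e.
    have [->|y0] := eqVneq y 0; first by rewrite enorm0 invr0 mulr0 ltW.
    rewrite ler_pdivrMr ?enorm_gt0// -(Ff _ xyq) -(Ff _ xq).
    by apply: (le_trans (H _ yd)); rewrite ler_pM2l// norm_le_enorm.
  apply: (@le_trans _ _ (e `^ p)).
    apply: ge0_ler_powR => //; rewrite ?nnegrE; [by apply: lnq0; rewrite lerDl|exact: ltW|].
    by apply: le_trans quote; apply: le_ln1Dx; exact: lt_le_trans quot0.
  by apply: ge1r_powR => //; rewrite e0.
have y0 : y <> 0 by move=> y0; apply: xyq; rewrite y0 addr0.
have ny0 : 0 < enorm y by rewrite enorm_gt0; exact/eqP.
have xyx : x + y <> x by move=> /eqP; rewrite -subr_eq0 addrAC subrr add0r => /eqP.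
rewrite excess_out//; have := fg xyx; move: xq (g0 x) (g0 (x + y)); rewrite /sublevel /=.
have Cgt0 : (0 < (2 `^ p * (1 + M `^ p))%:E)%E.
  by rewrite lte_fin mulr_gt0 ?powR_gt0// ltr_pwDl// powR_ge0.
case: (g x) => [a||]//; case: (g (x + y)) => [b||]//; last first.
  by move=> _ _ _ _; rewrite poweRyr ?gt_eqF ?(lt_le_trans ltr01 p1)// addey// gt0_muley// addey// leey.
rewrite !lee_fin => aq a0 b0 h.
have {}h : `|f (x + y) - f x| <= enorm (x + y - x) * (expR (b + a) - 1) by rewrite -lee_fin.
rewrite addrAC subrr add0r in h.
have quotb : 1 + `|f (x + y) - f x - dotv v y| / enorm y <= expR (q + b) * (1 + enorm v).
  have h1 : `|f (x + y) - f x - dotv v y| / enorm y <= (expR (b + a) - 1) + enorm v.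
    rewrite ler_pdivrMr// (le_trans (ler_normB _ _))// mulrDl (mulrC _ (enorm y)).
    by rewrite lerD// cauchy_schwarz.
  have h2 : expR (b + a) <= expR (q + b) by rewrite ler_expR; lra.
  have h3 : 1 <= expR (q + b) by rewrite -expR0 ler_expR addr_ge0.
  have := ler_wpM2r (enorm_ge0 v) h3; lra.
have lnb : ln (1 + `|f (x + y) - f x - dotv v y| / enorm y) <= M + b.
  apply: (@le_trans _ _ (ln (expR (q + b) * (1 + enorm v)))).
    rewrite ler_ln ?posrE//; first by rewrite ltr_pwDl.
    by rewrite mulr_gt0 ?expR_gt0// ltr_pwDl// enorm_ge0.
  by rewrite lnM ?posrE ?expR_gt0// ?ltr_pwDl ?enorm_ge0// expRK /M; lra.
have Mb0 : 0 <= M + b by rewrite addr_ge0.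
apply: (@le_trans _ _ ((M + b) `^ p)).
  by apply: ge0_ler_powR => //; rewrite ?nnegrE//; apply: lnq0; rewrite lerDl.
have max0 : 0 <= Num.max M b by rewrite le_max M0.
apply: (@le_trans _ _ ((2 * Num.max M b) `^ p)).
  apply: ge0_ler_powR => //; rewrite ?nnegrE ?mulr_ge0//.
  by rewrite mulr2n mulrDl !mul1r lerD// le_max lexx ?orbT.
rewrite powRM// -mulrA -[leLHS]add0r; apply: lerD; first exact: ltW.
apply: ler_wpM2l; first exact: powR_ge0.
have := powR_ge0 M p; have := powR_ge0 b p; set Mp := M `^ p; set bp := b `^ p => bp0 Mp0.
have : Num.max M b `^ p <= Mp + bp.
  by rewrite maxEle; case: ifP => _; rewrite /Mp /bp ?lerDl ?lerDr.
have := mulr_ge0 Mp0 bp0; rewrite mulrDl mul1r mulrDr mulr1; lra.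
Qed.

Lemma measurable_log_quotient x v : measurable_fun [set: 'rV[R]_d] (log_quotient x v).
Proof.
apply: (measurableT_comp (measurable_powR p)); apply: (measurableT_comp (@measurable_ln R)).
have mxy := measurable_rV_affine x (@ltr01 R).
have mfx : measurable_fun setT (fun y => f (x + y)).
  by have := measurableT_comp mf mxy; congr measurable_fun; apply/funext => y /=; rewrite scale1r.
have minv' : measurable_fun [set: 'rV[R]_d] (fun y => (enorm y)^-1).
  have := @measurable_inv_enorm R d 1 ltr01.
  by rewrite (_ : (fun y => _) = (fun y => (enorm y)^-1))//; apply/funext => y; rewrite mul1r.
have mnum : measurable_fun [set: 'rV[R]_d] (fun y => f (x + y) - f x - dotv v y).
  exact: measurable_funB (measurable_funB mfx (measurable_cst _)) (measurable_dotv v).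
have mabs := measurableT_comp (@normr_measurable R setT) mnum.
exact: measurable_funD (measurable_cst _) (measurable_funM mabs minv').
Qed.

Lemma tame_log_average q x v : tame q x v ->
  ((mu (eball r))^-1 * \int[mu]_(y in eball r) (log_quotient x v y)%:E)%E @[r --> 0^'+] --> 0%E.
Proof.
move=> xv; have [xq _ vx] := xv; have q0 := sublevel_ge0 xq.
have dR0 : 0 < d%:R :> R by rewrite ltr0n.
have mEb r : measurable (eball r : set 'rV[R]_d) := measurable_eball r.
have log0 y : (0 <= (log_quotient x v y)%:E)%E by rewrite lee_fin powR_ge0.
apply: cvg_at_right0_le => [r|e e0].
  by rewrite mule_ge0// ?inve_ge0 ?measure_ge0//; apply: integral_ge0 => y _.
set C := 2 `^ p * (1 + (q + ln (1 + enorm v)) `^ p).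
have C0 : 0 < C by rewrite mulr_gt0 ?powR_gt0// ltr_pwDl// powR_ge0.
pose e1 := Num.min (e / 2) 1; have e10 : 0 < e1 by rewrite lt_min divr_gt0//=.
have e11 : e1 <= 1 by rewrite ge_min lexx orbT.
have e1e : e1 <= e / 2 by rewrite ge_min lexx.
have ddC : 0 < C * d%:R ^+ d by rewrite mulr_gt0// exprn_gt0.
(* [C] undoes the constant of [log_quotient_le], and [d ^ d] the comparison of the Euclidean ball
   with the cube of radius [r / d] inside it. *)
have e20 : 0 < e / 2 / (C * d%:R ^+ d) by rewrite !divr_gt0.
have [d1 d10 H1] := log_quotient_le xv e10 e11.
have [d2 d20 H2] := vx _ e20.
exists (Num.min d1 d2); first by rewrite lt_min d10.
move=> r r0; rewrite lt_min => /andP[rd1 rd2].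
have mBr : measurable (ball x r) by exact: measurable_rV_ball.
have preB : (fun y => (x + y)%R) @^-1` ball x r = ball (0 : 'rV[R]_d) r.
  apply/seteqP; split => y; rewrite /= !ball_rVE /= sub0r normrN opprD addrA subrr add0r normrN //.
have mexc : measurable_fun [set: 'rV[R]_d] (fun y => excess q (x + y)%R).
  have := measurableT_comp (measurable_excess q) (measurable_rV_affine x (@ltr01 R)).
  by congr measurable_fun; apply/funext => y /=; rewrite scale1r.
have int_exc : (\int[mu]_(y in eball r) excess q (x + y)%R <= (e / 2 / (C * d%:R ^+ d) * r ^+ d)%:E)%E.
  apply: le_trans (H2 r r0 rd2).
  rewrite -(ge0_integral_rV_translate x mBr (measurable_funTS (measurable_excess q)) (excess_ge0 q)).
  rewrite preB; apply: (@ge0_subset_integral _ _ _ mu _ _ (mEb r) (measurable_rV_ball 0 r)).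
  - exact: measurable_funTS.
  - by move=> y _; exact: excess_ge0.
  - exact: eball_ball.
have le y : eball r y -> ((log_quotient x v y)%:E <= e1%:E + C%:E * excess q (x + y)%R)%E.
  by move=> yr; apply: H1; apply: le_lt_trans (norm_le_enorm y) (lt_trans yr rd1).
have int_log : (\int[mu]_(y in eball r) (log_quotient x v y)%:E <= e1%:E * mu (eball r) +
    C%:E * \int[mu]_(y in eball r) excess q (x + y)%R)%E.
  exact: (ge0_integral_le_affine mu (mEb r)
  (measurable_EFin_funTS (measurable_log_quotient x v)) (measurable_funTS mexc)
  log0 (fun y => excess_ge0 q (x + y)) (ltW e10) (ltW C0) le).
have mu_le : (mu (eball r) <= ((2 * r) ^+ d)%:E)%E.
  apply: le_trans (lebesgue_rV_ball_le 0 (ltW r0)).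
  by apply: le_outer_measure; exact: eball_ball.
have mu_ge : (((r / d%:R) ^+ d)%:E <= mu (eball r))%E.
  apply: le_trans (lebesgue_rV_ball_ge 0 (divr_gt0 r0 dR0)) _.
  by apply: le_outer_measure; exact: ball_eball.
move: mu_ge mu_le int_log; case: (mu (eball r)) => [m||]; first last.
- by rewrite leeNy_eq.
- by rewrite leye_eq.
rewrite !lee_fin => mge mle int_log.
have rd0 : 0 < (r / d%:R) ^+ d by rewrite exprn_gt0// divr_gt0.
have m0 : 0 < m by exact: lt_le_trans mge.
rewrite inver gt_eqF// lee_pdivrMl// -EFinM.
have h1 := lee_pmul (_ : 0 <= C%:E)%E _ (lexx C%:E) int_exc.
apply: (le_trans int_log); rewrite -EFinM.
apply: le_trans (leeD (lexx _) (h1 _ _)) _.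
- by rewrite lee_fin ltW.
- by apply: integral_ge0 => y _; exact: excess_ge0.
rewrite -EFinM -EFinD lee_fin.
have -> : C * (e / 2 / (C * d%:R ^+ d) * r ^+ d) = e / 2 * (r / d%:R) ^+ d.
  by rewrite expr_div_n; field; rewrite !gt_eqF// exprn_gt0.
have := ler_wpM2r (ltW m0) e1e; have e20' : 0 <= e / 2 by rewrite divr_ge0// ltW.
have := ler_wpM2l e20' mge; lra.
Qed.

End tame_points.

(** * Almost every point is tame *)

(** The preimage under [W] differs by null sets from the one glued from the [D k] on the [E k], and
    completeness makes null sets measurable. *)
Lemma complete_measurable_fun d (T : measurableType d) (R : realType)
    (mu : {measure set T -> \bar R}) (W : T -> R) (E : (set T)^nat) (D : nat -> T -> R) :
  measure_is_complete mu -> (forall k, measurable (E k)) ->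
  (forall k, measurable_fun setT (D k)) -> {ae mu, forall x, exists k, E k x} ->
  (forall k, {ae mu, forall x, E k x -> W x = D k x}) -> measurable_fun setT W.
Proof.
move=> cmu mE mD aeE aeD _ Y mY; rewrite setTI.
pose G := \bigcup_k (E k `&` D k @^-1` Y).
have mG : measurable G.
  apply: bigcupT_measurable => k; apply: measurableI => //.
  by rewrite -[X in measurable X]setTI; exact: mD.
have {}aeD := ae_foralln aeD.
have m1 : measurable (G `\` W @^-1` Y).
  apply: cmu; apply: negligibleS aeD => x [[k _ [Ex Dx]] Wx] /= H.
  by apply: Wx; rewrite /preimage /= (H k Ex).
have m2 : measurable (W @^-1` Y `\` G).
  apply: cmu; apply: negligibleS (negligibleU aeE aeD) => x [Wx Gx] /=.
  apply: contrapT => /not_orP[/contrapT[k Ex] /contrapT H].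
  by apply: Gx; exists k => //; split => //; rewrite /preimage /= -(H k Ex).
have -> : W @^-1` Y = (G `\` (G `\` W @^-1` Y)) `|` (W @^-1` Y `\` G).
  apply/seteqP; split => x.
    by move=> Wx; have [Gx|Gx] := pselect (G x); [left; split => // -[]|right].
  by move=> [[Gx nGW]|[]//]; apply: contrapT => Wx; exact: nGW.
by apply: measurableU => //; exact: measurableD.
Qed.

Section generalized_sobolev.
Context {R : realType} {d : nat} (p : R) (f : 'rV[R]_d -> R).
Hypothesis d0 : (0 < d)%N.
Hypothesis p1 : 1 <= p.
Hypothesis mf : measurable_fun [set: 'rV[R]_d] f.
Local Notation mu := (@lebesgue_rV R d).

Section majorant.
Variable g : 'rV[R]_d -> \bar R.
Hypothesis gmaj : N1p_majorant p f g.

Let p0 : 0 < p. Proof. exact: lt_le_trans p1. Qed.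
Let mg : measurable_fun [set: 'rV[R]_d] g. Proof. by case: gmaj. Qed.
Let g0 x : (0 <= g x)%E. Proof. by case: gmaj. Qed.
Let fg x y : x <> y -> (`|f x - f y|%:E <= (enorm (x - y))%:E * (expeR (g x + g y) - 1))%E.
Proof. by case: gmaj => _ _ _; exact. Qed.

Lemma majorant_LnormE : (Lnorm mu p%:E g `^ p)%E = (\int[mu]_x g x `^ p)%E.
Proof. by rewrite poweR_Lnorm ?gt_eqF//; apply: eq_integral => x _; rewrite gee0_abs. Qed.

Let mgp : measurable_fun setT (fun x => g x `^ p)%E.
Proof. exact: (measurableT_comp (measurable_poweR p) mg). Qed.

Let gp0 x : (0 <= g x `^ p)%E. Proof. exact: poweR_ge0. Qed.

Let int_gp : (\int[mu]_x g x `^ p < +oo)%E.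
Proof. by rewrite -majorant_LnormE; apply: poweR_lty; case: gmaj. Qed.

Lemma ae_majorant_lty : {ae mu, forall x, (g x < +oo)%E}.
Proof.
have intg : mu.-integrable setT (fun x => g x `^ p)%E.
  apply/integrableP; split; first exact: mgp.
  by under eq_integral do rewrite gee0_abs//.
have := integrable_ae measurableT intg; apply: filterS => x /(_ I).
by rewrite ge0_fin_numE// => /lty_poweRy; apply; rewrite gt_eqF.
Qed.

Lemma integral_excess_lty q N : (\int[mu]_(x in ball (0 : 'rV[R]_d)%R (N.+1%:R)%R) excess p g q x < +oo)%E.
Proof.
set B := ball _ _; have mB : measurable B by exact: measurable_rV_ball.
have le x : B x -> (excess p g q x <= 1%:E + 1%:E * g x `^ p)%E.
  move=> _; rewrite mul1e; have [xq|xq] := pselect (sublevel g q x).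
    by rewrite excess_sublevel// adde_ge0.
  by rewrite excess_out.
have := ge0_integral_le_affine mu mB (measurable_funTS (measurable_excess p mg q))
  (measurable_funTS mgp) (excess_ge0 p g q) gp0 ler01 ler01 le.
move=> /le_lt_trans; apply; rewrite !mul1e lte_add_pinfty//.
  by apply: le_lt_trans (ltry _); apply: lebesgue_rV_ball_le; rewrite ler0n.
apply: le_lt_trans int_gp.
exact: (@ge0_subset_integral _ _ _ mu _ _ mB measurableT _ mgp (fun x _ => gp0 x)).
Qed.

(** [F] is a parameter so that [measurable_weak_gradient] can read [v] off the difference quotients
    of a given extension. *)
Lemma ae_tame q F : extension f g q F ->
  {ae mu, forall x, sublevel g q x -> exists v, diff_at F x v /\ tame p f g q x v}.
Proof.
move=> extF; have [q0|q0] := ltP q 0.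
  by apply: aeW => x /(sublevel_ge0 g0); rewrite leNgt q0.
have [_ FK] := extF.
have K0 : 0 <= expR (2 * q) - 1 by rewrite subr_ge0 -expR0 ler_expR mulr_ge0.
have K1 : 0 < (expR (2 * q) - 1) * d%:R + 1 by rewrite ltr_pwDr// mulr_ge0.
have FK' x y : `|F x - F y| <= ((expR (2 * q) - 1) * d%:R + 1) * `|x - y|.
  apply: (le_trans (FK x y)); rewrite [leRHS]mulrDl mul1r -mulrA.
  by rewrite (le_trans (ler_wpM2l K0 (enorm_le_norm _)))// lerDl.
have := lebesgue_differentiation_zero_set (measurable_excess p mg q) (excess_ge0 p g q)
  (measurable_sublevel mg q) (integral_excess_lty q) (fun x => @excess_sublevel _ _ p g q x).
apply: filterS2 (rademacher K1 FK') => x [v Fv] Hx xq.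
by exists v; split => //; split => //; [exists F|exact: Hx].
Qed.

(** Rational levels are countably many, so one null set serves them all and tame levels exist
    arbitrarily close above [g x]. *)
Lemma ae_all_tame : {ae mu, forall x, (g x < +oo)%E /\
  forall q : rat, sublevel g (ratr q) x -> exists v, tame p f g (ratr q) x v}.
Proof.
have ext q : {ae mu, forall x, sublevel g q x -> exists v, tame p f g q x v}.
  have [q0|q0] := ltP q 0.
    by apply: aeW => x /(sublevel_ge0 g0); rewrite leNgt q0.
  have [F extF] := ex_extension g0 fg q0.
  by apply: filterS (ae_tame extF) => x H /H[v [_ xv]]; exists v.
have := ae_foralln (fun n => ext (ratr (odflt 0 (unpickle n)))).
apply: filterS2 ae_majorant_lty => x gx Hx; split => // q xq.
by have := Hx (pickle q); rewrite pickleK; exact.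
Qed.

Let tame_exists x : (g x < +oo)%E ->
  (forall q : rat, sublevel g (ratr q) x -> exists v, tame p f g (ratr q) x v) ->
  exists q v, tame p f g q x v.
Proof.
move=> gx H; have gfin : g x \is a fin_num by rewrite ge0_fin_numE.
have [|q] := @rat_in_itvoo R (fine (g x)) (fine (g x) + 1); first by rewrite ltrDl.
rewrite in_itv/= => /andP[gq _]; have [|v xv] := H q; last by exists (ratr q), v.
by rewrite /sublevel /= -(fineK gfin) lee_fin ltW.
Qed.

Lemma ae_weakly_differentiable : {ae mu, forall x, weakly_differentiable f x}.
Proof.
apply: filterS ae_all_tame => x [gx H]; have [q [v xv]] := tame_exists gx H.
by exists (dotv v); exact: tame_weak_differential xv.
Qed.

Lemma ae_log_average : {ae mu, forall x, ((mu (eball r))^-1 * \int[mu]_(y in eball r)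
  (log_quotient p f x (weak_gradient f x) y)%:E)%E @[r --> 0^'+] --> 0%E}.
Proof.
apply: filterS ae_all_tame => x [gx H]; have [q [v xv]] := tame_exists gx H.
rewrite (weak_gradientE d0 mf (tame_weak_differential mf mg xv)).
exact: tame_log_average xv.
Qed.

Lemma ae_log_gradient_le :
  {ae mu, forall x, ((ln (1 + enorm (weak_gradient f x)))%:E <= 2%:E * g x)%E}.
Proof.
apply: filterS ae_all_tame => x [gx H].
have gfin : g x \is a fin_num by rewrite ge0_fin_numE.
rewrite -(fineK gfin) -EFinM lee_fin; apply/ler_addgt0Pr => e e0.
have [|q] := @rat_in_itvoo R (fine (g x)) (fine (g x) + e / 2); first lra.
rewrite in_itv/= => /andP[gq qg].
have xq : sublevel g (ratr q) x by rewrite /sublevel /= -(fineK gfin) lee_fin ltW.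
have [v xv] := H q xq.
(* By uniqueness the gradient is the same at every level [q], although [v] was obtained from an
   extension depending on [q]. *)
rewrite (weak_gradientE d0 mf (tame_weak_differential mf mg xv)).
have := tame_gradient_bound g0 xv => vb.
apply: (@le_trans _ _ (2 * ratr q)); last by lra.
rewrite -[leRHS]expRK ler_ln ?posrE ?expR_gt0 ?ltr_pwDl ?enorm_ge0//; lra.
Qed.

(** On the sublevel of level [k] the gradient is almost everywhere that of the continuous [F k];
    these sublevels exhaust almost all of the space. *)
Lemma measurable_weak_gradient i :
  measurable_fun [set: 'rV[R]_d] (fun x => weak_gradient f x 0 i).
Proof.
have /choice[F extF] (k : nat) : exists F, extension f g k%:R F.
  by apply: (ex_extension g0 fg); rewrite ler0n.
pose Dq k n (x : 'rV[R]_d) := n.+1%:R * (F k (x + n.+1%:R^-1 *: delta_mx 0 i) - F k x).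
(* The upper limit is defined and measurable everywhere, and is the partial derivative wherever
   [F k] is differentiable. *)
pose D k x := fine (limn_esup (fun n => (Dq k n x)%:E)).
have cF k : continuous (F k).
  have K0 : 0 <= expR (2 * k%:R) - 1 :> R by rewrite subr_ge0 -expR0 ler_expR mulr_ge0.
  apply: (@lipschitz_rV_continuous _ _ ((expR (2 * k%:R) - 1) * d%:R + 1)) => [|x y].
    by rewrite ltr_pwDr// mulr_ge0.
  apply: (le_trans ((extF k).2 x y)); rewrite [leRHS]mulrDl mul1r -mulrA.
  by rewrite (le_trans (ler_wpM2l K0 (enorm_le_norm _)))// lerDl.
have mFk k := continuous_rV_measurable (cF k).
have mDq k n : measurable_fun setT (Dq k n).
  have mshift : measurable_fun [set: 'rV[R]_d] (fun x : 'rV[R]_d => x + n.+1%:R^-1 *: delta_mx 0 i).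
    rewrite (_ : (fun _ => _) = (fun x : 'rV[R]_d => n.+1%:R^-1 *: delta_mx 0 i + 1 *: x)).
      by exact: measurable_rV_affine.
    by apply/funext => x; rewrite scale1r addrC.
  exact: measurable_funM (measurable_cst _) (measurable_funB (measurableT_comp (mFk k) mshift) (mFk k)).
have mD k : measurable_fun setT (D k).
  have mesup := @measurable_fun_limn_esup _ _ _ setT (fun n x => (Dq k n x)%:E)
    (fun n => measurable_EFin_funTS (mDq k n)).
  exact: (measurableT_comp (@fine_measurable R setT measurableT) mesup).
apply: (complete_measurable_fun (@lebesgue_rV_is_complete R d)
  (fun k => measurable_sublevel mg k%:R) mD).
  apply: filterS ae_majorant_lty => x gx; have gfin : g x \is a fin_num by rewrite ge0_fin_numE.
  exists (Num.truncn (fine (g x))).+1; rewrite /sublevel /= -(fineK gfin) lee_fin ltW//.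
  exact: truncnS_gt.
move=> k; apply: filterS (ae_tame (extF k)) => x H /H[v [Fv xv]].
rewrite (weak_gradientE d0 mf (tame_weak_differential mf mg xv)) /D.
have cvgD : (Dq k n x)%:E @[n --> \oo] --> (v 0 i)%:E.
  apply: cvg_EFin; first exact: nearW.
  apply/cvgrPdist_le => e e0; have [dlt dlt0 Hd] := Fv e e0.
  near=> n; have n0 : 0 < n.+1%:R^-1 :> R by rewrite invr_gt0.
  pose y : 'rV[R]_d := n.+1%:R^-1 *: delta_mx 0 i.
  have yn : `|y| <= n.+1%:R^-1.
    apply/rV_norm_leP => [|j]; first exact: ltW.
    by rewrite !mxE eqxx /=; case: (_ == _); rewrite ?mulr1 ?mulr0 ?normr0 ?gtr0_norm// ltW.
  have yd : `|y| < dlt.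
    apply: (le_lt_trans yn); near: n; exact: (near_infty_natSinv_lt (PosNum dlt0)).
  have := Hd y yd; rewrite dotv_delta /= => h.
  have -> : v 0 i - Dq k n x = - (n.+1%:R * (F k (x + y) - F k x - v 0 i * n.+1%:R^-1)).
    by rewrite /Dq -/y; field; rewrite ?(addrC 1) ?natr1 pnatr_eq0.
  rewrite normrN normrM ger0_norm// -ler_pdivlMl//.
  by apply: (le_trans h); rewrite mulrC ler_pM2r.
by have [_ ->] := cvg_limn_einf_sup cvgD.
Unshelve. all: by end_near. Qed.

Lemma measurable_log_gradient :
  measurable_fun [set: 'rV[R]_d] (fun x => ln (1 + enorm (weak_gradient f x)) `^ p).
Proof.
apply: (measurableT_comp (measurable_powR p)); apply: (measurableT_comp (@measurable_ln R)).
have msq : measurable_fun [set: 'rV[R]_d] (fun x => dotv (weak_gradient f x) (weak_gradient f x)).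
  apply: measurable_sum => i; exact: measurable_funM (measurable_weak_gradient i) (measurable_weak_gradient i).
have msqrt := continuous_measurable_fun (@sqrt_continuous R).
exact: measurable_funD (measurable_cst _) (measurableT_comp msqrt msq).
Qed.

Lemma integral_log_gradient_le :
  (\int[mu]_x (ln (1 + enorm (weak_gradient f x)) `^ p)%:E <=
   (2 `^ p)%:E * Lnorm mu p%:E g `^ p)%E.
Proof.
have C0 : (0 <= (2 `^ p)%:E :> \bar R)%E by rewrite lee_fin powR_ge0.
rewrite majorant_LnormE -(ge0_integralZl mu measurableT mgp (fun x _ => gp0 x) C0).
have log0 x : setT x -> (0 <= (ln (1 + enorm (weak_gradient f x)) `^ p)%:E)%E.
  by move=> _; rewrite lee_fin powR_ge0.
have rhs0 x : setT x -> (0 <= (2 `^ p)%:E * g x `^ p)%E by move=> _; rewrite mule_ge0.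
have mrhs : measurable_fun setT (fun x => (2 `^ p)%:E * g x `^ p)%E by exact: measurable_funeM.
apply: (ae_ge0_le_integral measurableT log0 (measurable_EFin_funTS measurable_log_gradient) rhs0 mrhs).
apply: filterS ae_log_gradient_le => x Hx _.
rewrite -!poweR_EFin -poweRM//; apply: gt0_ler_poweR => //.
- exact: ltW.
- by rewrite in_itv/= lee_fin leey andbT ln_ge0// lerDl enorm_ge0.
- by rewrite in_itv/= leey andbT mule_ge0.
Qed.

End majorant.

End generalized_sobolev.

(** * Passage to the infimum over majorants, and conclusion *)

Lemma le_mul_ereal_inf_poweR (R : realType) (p c : R) (A : \bar R) (S : set (\bar R)) :
  0 < p -> 0 < c -> (0 <= A)%E -> (forall s, S s -> 0 <= s)%E ->
  (forall s, S s -> A <= c%:E * s `^ p)%E -> (A <= c%:E * ereal_inf S `^ p)%E.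
Proof.
move=> p0 c0 A0 S0 AS; have pi0 : 0 <= p^-1 by rewrite invr_ge0 ltW.
have Ac0 : (0 <= c^-1%:E * A)%E by rewrite mule_ge0// lee_fin invr_ge0 ltW.
have in0y (x : \bar R) : (0 <= x)%E -> x \in `[0%E, +oo%E] by move=> x0; rewrite in_itv/= x0 leey.
(* The infimum need not be attained: solving the inequality for [s] gives a lower bound [t] of
   [S]. *)
pose t := ((c^-1%:E * A) `^ p^-1)%E.
have tS : (t <= ereal_inf S)%E.
  apply: le_ereal_inf_tmp => s Ss; have s0 := S0 s Ss.
  have -> : s = ((s `^ p) `^ p^-1)%E by rewrite -poweRrM mulfV ?gt_eqF// poweRe1.
  apply: gt0_ler_poweR => //; rewrite ?in0y ?poweR_ge0//.
  by rewrite lee_pdivrMl//; exact: AS.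
have t0 : (0 <= t)%E by exact: poweR_ge0.
rewrite -lee_pdivrMl//.
have -> : (c^-1%:E * A = t `^ p)%E by rewrite -poweRrM mulVf ?gt_eqF// poweRe1.
apply: gt0_ler_poweR => //; rewrite ?in0y//; first exact: ltW.
exact: le_trans tS.
Qed.

Theorem proposition3p6 (R : realType) (d : nat) (p : R)
    (hd : (1 <= d)%N) (hp : 1 <= p) :
  [/\ forall f : 'rV[R]_d -> R, N1p p f ->
        {ae @lebesgue_rV R d, forall x, weakly_differentiable f x},
      exists C : R, 0 < C /\
        forall f : 'rV[R]_d -> R, N1p p f ->
          measurable_fun [set: 'rV[R]_d]
            (fun x => ln (1 + enorm (weak_gradient f x)) `^ p) /\
          (\int[@lebesgue_rV R d]_x (ln (1 + enorm (weak_gradient f x)) `^ p)%:E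
           <= C%:E * N1p_seminorm p f `^ p)%E &
      forall f : 'rV[R]_d -> R, N1p p f ->
        {ae @lebesgue_rV R d, forall x,
          ((@lebesgue_rV R d (@eball R d r))^-1 *
           \int[@lebesgue_rV R d]_(y in @eball R d r)
             (ln (1 + `|f (x + y) - f x - dotv (weak_gradient f x) y| / enorm y)
                `^ p)%:E)%E
            @[r --> 0^'+] --> 0%E}].
Proof.
split.
- by move=> f [[mf _] [g gmaj]]; exact: ae_weakly_differentiable hp mf g gmaj.
(* The constant is the [p]-th power of the factor in [ln (1 + |grad f|) <= 2 g], which holds for
   every majorant [g]. *)
- exists (2 `^ p); split; first exact: powR_gt0.
  move=> f [[mf _] [g gmaj]]; split; first exact: measurable_log_gradient hd hp mf g gmaj.
  apply: le_mul_ereal_inf_poweR; [exact: lt_le_trans hp|exact: powR_gt0| | |].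
  + by apply: integral_ge0 => x _; rewrite lee_fin powR_ge0.
  + by move=> _ [h _ <-]; exact: Lnorm_ge0.
  + by move=> _ [h hmaj <-]; exact: integral_log_gradient_le hd hp mf h hmaj.
- by move=> f [[mf _] [g gmaj]]; exact: ae_log_average hd hp mf g gmaj.
Qed.
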